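(* Let $\mathcal G$ be a finite tree (with edge lengths), let $S$ be its metric graph, of total length $\zeta$, and let $f\in\mathcal F^1_*$. (i) Then $f(0)$ is the centroid of $S$. (ii) Suppose that $t\in(t_{k-1},t_k)$ for some $1\le k\le\mathbf k(f)$. For $1\le j\le m_k$ let $S^k_j(t)$ be the component of $S\setminus\{x^k_j(t)\}$ which does not contain $f(0)$, and let $\zeta^k_j(t)$ be the total length of edges in $S^k_j(t)$. Then for every $1\le j\le m_k$ $$z^k_j=\dot x^k_j(t)=\frac{\zeta^k_j(t)}{\sum_{i=1}^{m_k}\zeta^k_i(t)}=\frac{\zeta^k_j(t)}{\zeta-t}.$$
   Context: **Metric graphs.** $\mathcal G=(\mathcal V,\mathcal E)$ is a finite connected simple graph with a length function $\ell:\mathcal E\to(0,\infty)$. Each edge is given an arbitrary orientation. $S$ is the quotient of $\bigcup_{e\in\mathcal E}\{e\}\times[0,\ell(e)]$ obtained by identifying points representing the same vertex ($(e,0)$ is the initial vertex of $e$, $(e,\ell(e))$ the terminal one); points are written $(e,x)$. $S$ carries the shortest-path metric and its topology; $\zeta=\sum_e\ell(e)$. **Normal vectors.** For each edge $e$ there are two symbols $e^+,e^-$ with $\mathrm{sign}(e^{\pm})=\pm1$, and $(e,s)+t\mathbf w=(e,s+\mathrm{sign}(\mathbf w)t)$ for $\mathbf w\in\{e^+,e^-\}$ whenever $0\le s+\mathrm{sign}(\mathbf w)t\le \ell(e)$. $e^+$ is anchored at a point $p$ if $p=(e,s)$ with $0\le s<\ell(e)$; $e^-$ is anchored at $p$ if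 $p=(e,s)$ with $0<s\le\ell(e)$. For a closed set $A\subset S$ with finitely many components and $p\in\partial A$, $\mathbf w$ is an outward normal vector to $A$ at $p$ if $\mathbf w$ is anchored at $p$ and for some $t_1>0$, $p+t\mathbf w\notin A$ for all $t\in(0,t_1)$. **Floodings.** A flooding is a family $(f(t),t\ge0)$ of increasing closed subsets of $S$, each with finitely many components, for which there are times $0=t_0<t_1<\dots<t_{\mathbf k(f)}<\infty$ such that $f(t)=S$ for $t\ge t_{\mathbf k(f)}$, and for $k=1,\dots,\mathbf k(f)$: $f(t_{k-1})\ne S$; $\mathbf w^k_1,\dots,\mathbf w^k_{m_k}$ are all outward normal vectors at all points of $\partial f(t_{k-1})$ (so $m_k$ is their total number), with $\mathbf w^k_j\in\{(e^k_j)^+,(e^k_j)^-\}$ anchored at the boundary point $(e^k_j,r^k_j)$; there are $z^k_j\ge0$ with $\sum_{j=1}^{m_k}z^k_j=1$; $t_k$ is the infimum of $t>t_{k-1}$ such that for some $j$, $r^k_j+\mathrm{sign}(\mathbf w^k_j)z^k_j(t-t_{k-1})\notin[0,\ell(e^k_j)]$, or for some $j_1\neq j_2$ with $e^k_{j_1}=e^k_{j_2}$, $r^k_{j_1}+\mathrm{sign}(\mathbf w^k_{j_1})z^k_{j_1}(t-t_{k-1})=r^k_{j_2}+\mathrm{sign}(\mathbf w^k_{j_2})z^k_{j_2}(t-t_{k-1})$; and, with $x^k_j(t)=(e^k_j,r^k_j)+(t-t_{k-1})z^k_j\mathbf w^k_j$, for $t\in[t_{k-1},t_k]$ one has $f(t)=f(t_{k-1})\cup\{x^k_j(s):1\le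 j\le m_k,\ t_{k-1}\le s\le t\}$. One writes $\dot x^k_j(t)=z^k_j$ for $t\in(t_{k-1},t_k)$ (speed of the $j$-th arm). $\mathcal F^1$ is the set of floodings such that $f(0)$ is a single point (the singleton is identified with the point); then $t_{\mathbf k(f)}=\zeta$. **Entropy.** With $0\log0=0$, $\beta(f)=-\sum_{k=1}^{\mathbf k(f)}(t_k-t_{k-1})\sum_{j=1}^{m_k}z^k_j\log z^k_j$, and $\mathcal F^1_*=\{f\in\mathcal F^1:\beta(f)=\sup_{g\in\mathcal F^1}\beta(g)\}$. **Centroid.** A point $v\in S$ is the centroid of the tree metric graph $S$ if for every connected subset $A$ of $S\setminus\{v\}$, the total length of edges in $A$ is at most $\zeta/2$ (such a point exists and is unique). *)

(* Defs.v *)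
From HB Require Import structures.
From mathcomp Require Import all_boot all_order all_algebra.
From mathcomp Require Import generic_quotient.
From mathcomp Require Import all_classical all_reals all_analysis.
From mathcomp Require Import lra.

Set Implicit Arguments.
Unset Strict Implicit.
Unset Printing Implicit Defensive.

Import Order.TTheory GRing.Theory Num.Theory.
Import numFieldNormedType.Exports.

Local Open Scope classical_set_scope.
Local Open Scope ring_scope.
Local Open Scope quotient_scope.

Definition adjacent (V E : finType) (src tgt : E -> V) : rel V :=
  [rel u v | [exists e, ((src e, tgt e) == (u, v)) || ((src e, tgt e) == (v, u))]].

Record metric_graph (R : realType) := MetricGraph {
  vertex : finType;
  edge : finType;
  src : edge -> vertex;
  tgt : edge -> vertex;
  len : edge -> R;
  no_loop : forall e, src e != tgt e;
  no_multi_edge : forall e e',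
    (src e, tgt e) = (src e', tgt e') \/ (src e, tgt e) = (tgt e', src e') ->
    e = e';
  graph_connected : forall u v, connect (adjacent src tgt) u v;
  len_gt0 : forall e, 0 < len e }.

(* Graphs being connected, only acyclicity remains to be required.  In a simple
   graph a cycle has at least three vertices; [cycle] also accepts the empty
   sequence and the back-and-forth walk along one edge. *)
Definition is_tree (R : realType) (G : metric_graph R) : Prop :=
  forall c : seq (vertex G),
    uniq c -> cycle (adjacent (@src _ G) (@tgt _ G)) c -> (size c <= 2)%N.

Section metric_graph_points.
Context {R : realType} (G : metric_graph R).
Implicit Types (e : edge G) (x y : R).

Definition raw_point : Type := {a : edge G * R | 0 <= a.2 <= len a.1}.

HB.instance Definition _ := Choice.on raw_point.

Definition vertex_of (a : raw_point) : option (vertex G) :=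
  if (val a).2 == 0 then Some (src (val a).1)
  else if (val a).2 == len (val a).1 then Some (tgt (val a).1) else None.

Definition same_point : rel raw_point := fun a b =>
  (a == b) || ((vertex_of a != None) && (vertex_of a == vertex_of b)).

Lemma same_point_refl : reflexive same_point.
Proof. by move=> a; rewrite /same_point eqxx. Qed.

Lemma same_point_sym : symmetric same_point.
Proof.
move=> a b; rewrite /same_point eq_sym (eq_sym (vertex_of b) (vertex_of a)).
by case: (vertex_of a =P vertex_of b) => [->//|]; rewrite !andbF.
Qed.

Lemma same_point_trans : transitive same_point.
Proof.
move=> b a c /orP[/eqP->//|/andP[na /eqP ab]] /orP[/eqP<-|/andP[_ /eqP bc]].
  by rewrite /same_point na ab eqxx orbT.
by rewrite /same_point na ab bc eqxx orbT.
Qed.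

Canonical same_point_equiv :=
  EquivRel same_point same_point_refl same_point_sym same_point_trans.

Definition points : Type := {eq_quot same_point_equiv}.

HB.instance Definition _ := Choice.on points.
HB.instance Definition _ := EqQuotient.on points.

Definition clamp e x : R := Num.max 0 (Num.min x (len e)).

Lemma clampP e x : 0 <= clamp e x <= len e.
Proof.
by rewrite /clamp le_max lexx /= ge_max (ltW (len_gt0 e)) ge_min lexx orbT.
Qed.

Lemma clampE e x : 0 <= x <= len e -> clamp e x = x.
Proof. by move=> /andP[x0 xl]; rewrite /clamp min_l// max_r. Qed.

Definition raw e x : raw_point :=
  exist (fun a : edge G * R => 0 <= a.2 <= len a.1) (e, clamp e x) (clampP e x).

(* The point written (e, x).  It is meant for 0 <= x <= len e; other values of
   x are projected to the nearer end of e. *)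
Definition pt e x : points := \pi_points (raw e x).

Lemma raw_val (a : raw_point) : raw (val a).1 (val a).2 = a.
Proof.
by apply: val_inj; case: a => -[e x] /= h; rewrite clampE.
Qed.

Lemma ptP (p : points) : exists e x, 0 <= x <= len e /\ p = pt e x.
Proof.
exists (val (repr p)).1, (val (repr p)).2; split; first by case: (repr p).
by rewrite /pt raw_val reprK.
Qed.

Lemma vertex_of_src e : vertex_of (raw e 0) = Some (src e).
Proof. by rewrite /vertex_of/= clampE ?eqxx// lexx ltW// len_gt0. Qed.

Lemma vertex_of_tgt e : vertex_of (raw e (len e)) = Some (tgt e).
Proof.
by rewrite /vertex_of/= clampE ?lexx ?andbT ?ltW ?len_gt0// eqxx gt_eqF ?len_gt0.
Qed.

(* [walk p q l]: some path from p to q made of finitely many edge segments has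
   length l. *)
Inductive walk : points -> points -> R -> Prop :=
| walk_edge e x y : 0 <= x <= len e -> 0 <= y <= len e ->
    walk (pt e x) (pt e y) `|x - y|
| walk_cat p q r l l' : walk p q l -> walk q r l' -> walk p r (l + l').

Definition dist (p q : points) : R := inf [set l | walk p q l].

Lemma walk_ge0 p q l : walk p q l -> 0 <= l.
Proof. by elim=> // *; apply: addr_ge0. Qed.

Lemma walk_sym p q l : walk p q l -> walk q p l.
Proof.
elim=> [e x y hx hy|{}p {}q r {}l l' _ qp _ rq]; first by rewrite distrC; constructor.
by rewrite addrC; apply: walk_cat rq qp.
Qed.

Lemma walk_refl p : walk p p 0.
Proof.
have [e [x [hx ->]]] := ptP p.
by have := walk_edge hx hx; rewrite subrr normr0.
Qed.

Let end_in e (b : bool) : 0 <= (if b then 0 else len e) <= len e.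
Proof. by case: b; rewrite lexx ?andbT ltW// len_gt0. Qed.

Let end_pt e b : points := pt e (if b then 0 else len e).
Let end_vx e b : vertex G := if b then src e else tgt e.

Lemma end_ptE e b e' b' : end_vx e b = end_vx e' b' -> end_pt e b = end_pt e' b'.
Proof.
have vE e1 b1 : vertex_of (raw e1 (if b1 then 0 else len e1)) = Some (end_vx e1 b1).
  by case: b1; rewrite ?vertex_of_src ?vertex_of_tgt.
move=> h; apply/eqquotP; rewrite /= /same_point !vE h eqxx/=.
by rewrite orbT.
Qed.

Lemma walk_ends e b e' b' : exists l, walk (end_pt e b) (end_pt e' b') l.
Proof.
have /connectP[s] := graph_connected (end_vx e b) (end_vx e' b').
elim: s e b => [|u s ih] e b /=.
  by move=> _ /esym/end_ptE->; exists 0; apply: walk_refl.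
move=> /andP[/existsP[e1 h]] hs hl.
have [b1 [h1 h2]] : exists b1, end_vx e b = end_vx e1 b1 /\ u = end_vx e1 (~~ b1).
  by case/orP: h => /eqP[hv hu]; [exists true|exists false]; rewrite /end_vx.
move: hs hl; rewrite h2 => hs hl.
have [l wl] := ih e1 (~~ b1) hs hl.
exists (`|(if b1 then 0 else len e1) - (if ~~ b1 then 0 else len e1)| + l).
rewrite (end_ptE h1); apply: walk_cat wl.
by apply: walk_edge; apply: end_in.
Qed.

Lemma walk_ex p q : exists l, walk p q l.
Proof.
have [e [x [hx ->]]] := ptP p; have [e' [x' [hx' ->]]] := ptP q.
have [l wl] := walk_ends e true e' true.
exists (`|x - 0| + (l + `|0 - x'|)); apply: walk_cat.
  by apply: walk_edge => //; apply: (end_in e true).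
apply: walk_cat wl _.
by apply: walk_edge => //; apply: (end_in e' true).
Qed.

Lemma walk_has_inf p q : has_inf [set l | walk p q l].
Proof.
split; first exact: walk_ex.
by exists 0 => l; apply: walk_ge0.
Qed.

Lemma dist_ge0 p q : 0 <= dist p q.
Proof.
by apply: lb_le_inf; [exact: walk_ex|move=> l; apply: walk_ge0].
Qed.

Lemma dist_le p q l : walk p q l -> dist p q <= l.
Proof. by move=> wl; apply: ge_inf => //; case: (walk_has_inf p q). Qed.

Lemma distxx p : dist p p = 0.
Proof. by apply/eqP; rewrite eq_le dist_ge0 andbT; apply/dist_le/walk_refl. Qed.

Lemma dist_sym p q : dist p q = dist q p.
Proof. by congr inf; apply/seteqP; split=> l; apply: walk_sym. Qed.

Lemma dist_triangle q p r : dist p r <= dist p q + dist q r.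
Proof.
rewrite -lerBlDr; apply: lb_le_inf; first exact: walk_ex.
move=> l wl; rewrite lerBlDr -lerBlDl.
apply: lb_le_inf; first exact: walk_ex.
by move=> l' wl'; rewrite lerBlDl; apply/dist_le/(walk_cat wl wl').
Qed.

(* A point is separated from the others by a 1-Lipschitz function, namely its
   distance truncated at a small enough value. *)
Lemma dist_lipschitz (phi : raw_point -> R) p q :
  (forall a b, same_point a b -> phi a = phi b) ->
  (forall e x y, 0 <= x <= len e -> 0 <= y <= len e ->
     `|phi (raw e x) - phi (raw e y)| <= `|x - y|) ->
  `|phi (repr p) - phi (repr q)| <= dist p q.
Proof.
move=> phiE phiL; apply: lb_le_inf; first exact: walk_ex.
move=> l; elim=> [e x y hx hy|p1 q1 r1 l1 l2 _ h1 _ h2].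
  have phir z : phi (repr (pt e z)) = phi (raw e z).
    by apply: phiE; have /eqquotP := reprK (pt e z).
  by rewrite !phir; apply: phiL.
by apply: le_trans (ler_distD (phi (repr q1)) _ _) _; apply: lerD.
Qed.

Let len_min : exists2 c : R, 0 < c & forall e, c <= len e.
Proof.
exists (\big[Num.min/1]_(e : edge G) len e).
  by elim/big_ind: _ => // [x y x0 y0|e _]; rewrite ?lt_min ?x0// len_gt0.
by move=> e; apply: bigmin_le_cond.
Qed.

Local Ltac min_cases := repeat match goal with
  |- context [Num.min ?a ?b] =>
    lazymatch constr:((a, b)) with
    | context [Num.min _ _] => fail
    | _ => rewrite (minElt a b); case: (ltP a b) => ?
    end
  end.

Let min_lip (c x y u v : R) : `|x - y| <= `|u - v| ->
  `|Num.min c x - Num.min c y| <= `|u - v|.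
Proof.
move=> h; apply: le_trans h.
have h1 := ler_norm (x - y); have h2 := ler_norm (y - x).
rewrite (distrC y) in h2; rewrite ler_norml.
move: h1 h2; set n := `|x - y| => h1 h2.
by rewrite !minElt; case: (ltP c x); case: (ltP c y) => *; apply/andP; split; lra.
Qed.

Lemma dist_eq0 p q : dist p q = 0 -> p = q.
Proof.
move=> pq0.
suff [phi [phiE phiL phi0 phi_gt0]] : exists phi : raw_point -> R,
  [/\ forall a b, same_point a b -> phi a = phi b,
      forall e x y, 0 <= x <= len e -> 0 <= y <= len e ->
        `|phi (raw e x) - phi (raw e y)| <= `|x - y|,
      phi (repr p) = 0 & forall a, phi a = 0 -> same_point (repr p) a].
  have := dist_lipschitz p q phiE phiL.
  rewrite pq0 phi0 sub0r normrN normr_le0 => /eqP /phi_gt0 h.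
  by rewrite -[p]reprK -[q]reprK; apply/eqquotP.
have [c0 c0_gt0 c0len] := len_min.
case: (repr p) => -[e0 x0] h0; set a0 := exist _ _ _.
have -> : a0 = raw e0 x0 by apply: val_inj => /=; rewrite clampE.
have {a0} rE e x : 0 <= x <= len e -> val (raw e x) = (e, x).
  by move=> h; rewrite /= clampE.
case vE: (vertex_of (raw e0 x0)) => [u|].
  pose d (a : raw_point) := Num.min
    (if src (val a).1 == u then (val a).2 else c0)
    (if tgt (val a).1 == u then len (val a).1 - (val a).2 else c0).
  have dv a w : vertex_of a = Some w ->
      Num.min c0 (d a) = if w == u then 0 else c0.
    move: (valP a); rewrite /vertex_of /d; case: (val a) => e x /= /andP[x_ge0 xl].
    have nl := no_loop e; have c0e := c0len e; have le0 := len_gt0 e.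
    case: (x =P 0) => [x_0 [<-]|_].
      rewrite x_0 subr0; case: (src e =P u) nl => [->|_] nl.
        rewrite eq_sym (negbTE nl); min_cases; lra.
      case: (tgt e == u); min_cases; lra.
    case: (x =P len e) => // -> [<-]; rewrite subrr.
    case: (tgt e =P u) nl => [->|_] nl.
      rewrite (negbTE nl); min_cases; lra.
    case: (src e == u); min_cases; lra.
  exists (fun a => Num.min c0 (d a)); split.
  - move=> a b /orP[/eqP->//|/andP[]].
    case va: (vertex_of a) => [w|]// _ /eqP/esym vb.
    by rewrite (dv _ _ va) (dv _ _ vb).
  - move=> e x y hx hy; rewrite /d !rE//=; apply: min_lip.
    have nl := no_loop e.
    case: (src e =P u) nl => [->|_] nl.
      rewrite eq_sym (negbTE nl) ![Num.min _ c0]minC; exact: min_lip.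
    case: (tgt e == u); last by rewrite minxx subrr normr0.
    apply: min_lip; rewrite distrC (_ : _ - _ = x - y)//; lra.
  - by rewrite (dv _ _ vE) eqxx.
  - move=> a ha.
    suff va : vertex_of a = Some u by rewrite /same_point vE va eqxx orbT.
    move: ha (valP a); rewrite /d /vertex_of; case: (val a) => e x /= ha.
    move=> /andP[x_ge0 xl]; have nl := no_loop e; have le0 := len_gt0 e.
    case: (src e =P u) nl ha => [su|_] nl.
      rewrite -su eq_sym (negbTE nl) => ha.
      have -> : x = 0 by move: ha; min_cases; lra.
      by rewrite eqxx.
    case: (tgt e =P u) => [tu|_] ha.
      have -> : x = len e by move: ha; min_cases; lra.
      by rewrite eqxx gt_eqF// tu.
    by exfalso; move: ha; min_cases; lra.
have x0_gt0 : 0 < x0.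
  rewrite lt0r; case/andP: (h0) => /= -> _; rewrite andbT; apply/negP => /eqP z0.
  by move: vE; rewrite /vertex_of rE//= z0 eqxx.
have x0_lt : x0 < len e0.
  rewrite lt_neqAle; case/andP: (h0) => /= _ ->; rewrite andbT; apply/negP => /eqP z0.
  by move: vE; rewrite /vertex_of rE//= gt_eqF// z0 eqxx.
pose c := Num.min x0 (len e0 - x0).
have c_gt0 : 0 < c by rewrite /c lt_min x0_gt0 subr_gt0.
have cl : c <= x0 by rewrite /c ge_min lexx.
have cr : c <= len e0 - x0 by rewrite /c ge_min lexx orbT.
pose d (a : raw_point) := if (val a).1 == e0 then `|(val a).2 - x0| else c.
have dv a w : vertex_of a = Some w -> Num.min c (d a) = c.
  rewrite /vertex_of /d; case: (val a) => e x /=.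
  case: (e =P e0) => [->|_]; last by rewrite minxx.
  case: (x =P 0) => [-> _|_].
    by rewrite sub0r normrN gtr0_norm// min_l.
  by case: (x =P len e0) => // -> _; rewrite gtr0_norm ?subr_gt0// min_l.
exists (fun a => Num.min c (d a)); split.
- move=> a b /orP[/eqP->//|/andP[]].
  case va: (vertex_of a) => [w|]// _ /eqP/esym vb.
  by rewrite (dv _ _ va) (dv _ _ vb).
- move=> e x y hx hy; rewrite /d !rE//=; apply: min_lip.
  case: (e == e0); last by rewrite subrr normr0.
  apply: le_trans (ler_dist_dist _ _) _.
  by rewrite opprB addrA subrK.
- by rewrite /d rE//= eqxx subrr normr0 min_r// ltW.
- move=> a; rewrite /d => ha.
  suff -> : a = raw e0 x0 by apply: same_point_refl.
  apply: val_inj; rewrite rE//; move: ha; case: (val a) => e x /=.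
  case: (e =P e0) => [->|_]; last by rewrite minxx => c_0; move: c_gt0; rewrite c_0 ltxx.
  rewrite minElt; case: ltP => [_ c_0|_ /eqP]; first by move: c_gt0; rewrite c_0 ltxx.
  by rewrite normr_eq0 subr_eq0 => /eqP->.
Qed.

HB.instance Definition _ := @isMetric.Build R points dist
  distxx dist_eq0 dist_sym dist_triangle.

Definition finitely_many_components (A : set points) : Prop :=
  finite_set [set connected_component A p | p in A].

Definition frontier (A : set points) : set points := closure A `\` A^°.

(* Total length of the parts of edges lying in A. *)
Definition length_in (A : set points) : R :=
  \sum_(e : edge G)
    fine (lebesgue_measure [set x : R | 0 <= x <= len e /\ A (pt e x)]).

Definition total_length : R := \sum_(e : edge G) len e.

Definition is_centroid (v : points) : Prop :=
  forall A : set points, connected A -> A `<=` ~` [set v] ->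
    length_in A <= total_length / 2.

(* [C] is a component of S \ {x} which does not contain v. *)
Definition is_branch (v x : points) (C : set points) : Prop :=
  (exists2 p, (~` [set x]) p & C = connected_component (~` [set x]) p) /\ ~ C v.

(* The symbol e^+ or e^- (according to [nplus]) together with the coordinate of
   the point at which it is anchored. *)
Record normal_vector := NormalVector {
  nedge : edge G;
  nplus : bool;
  npos : R }.

Implicit Types w : normal_vector.

Definition nsign w : R := if nplus w then 1 else -1.

Definition coord w (d : R) : R := npos w + nsign w * d.

Definition move_along w (d : R) : points := pt (nedge w) (coord w d).

Definition anchored w : Prop :=
  if nplus w then 0 <= npos w < len (nedge w) else 0 < npos w <= len (nedge w).

Definition outward_normals (A : set points) : set normal_vector :=
  [set w | [/\ anchored w, frontier A (pt (nedge w) (npos w)) &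
    exists2 t1 : R, 0 < t1 & forall t : R, 0 < t < t1 -> ~ A (move_along w t)]].

End metric_graph_points.

(* The arms are stopped when one of them leaves its edge or two of them meet. *)
Definition stopping_times (R : realType) (G : metric_graph R) (t0 : R) (m : nat)
    (w : 'I_m -> normal_vector G) (z : 'I_m -> R) : set R :=
  [set t : R | t0 < t /\
    ((exists j, ~ (0 <= coord (w j) (z j * (t - t0)) <= len (nedge (w j)))) \/
     (exists j1 j2, [/\ j1 <> j2, nedge (w j1) = nedge (w j2) &
        coord (w j1) (z j1 * (t - t0)) = coord (w j2) (z j2 * (t - t0))]))].

(* Phases are numbered from 0: phase k < nphases takes place on the interval
   [times k, times k.+1], and [narms k], [arm k], [speed k] are the number of
   arms, the outward normal vectors and the speeds during that phase.  The
   values of [flood] at negative times and of the other fields beyond the last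
   phase are irrelevant. *)
Record flooding (R : realType) (G : metric_graph R) := Flooding {
  flood :> R -> set (points G);
  nphases : nat;
  times : nat -> R;
  narms : nat -> nat;
  arm : forall k, 'I_(narms k) -> normal_vector G;
  speed : forall k, 'I_(narms k) -> R;
  flood_mono : forall s t : R, 0 <= s <= t -> flood s `<=` flood t;
  flood_closed : forall t : R, 0 <= t -> closed (flood t);
  flood_components : forall t : R, 0 <= t -> finitely_many_components (flood t);
  times0 : times 0 = 0;
  times_lt : forall k, (k < nphases)%N -> times k < times k.+1;
  flood_end : forall t, times nphases <= t -> flood t = setT;
  flood_neqT : forall k, (k < nphases)%N -> flood (times k) <> setT;
  arm_inj : forall k, (k < nphases)%N -> injective (@arm k);
  arm_range : forall k, (k < nphases)%N ->
    range (@arm k) = outward_normals (flood (times k));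
  speed_ge0 : forall k, (k < nphases)%N -> forall j : 'I_(narms k), 0 <= speed j;
  speed_sum : forall k, (k < nphases)%N -> \sum_(j < narms k) speed j = 1;
  times_inf : forall k, (k < nphases)%N ->
    (times k.+1)%:E =
      ereal_inf [set t%:E | t in stopping_times (times k) (@arm k) (@speed k)];
  flood_phase : forall k, (k < nphases)%N ->
    forall t, times k <= t <= times k.+1 ->
    flood t = flood (times k) `|`
      [set p | exists (j : 'I_(narms k)) (s : R), times k <= s <= t /\
         p = move_along (arm j) (speed j * (s - times k))] }.

Arguments arm {R G} f k j : rename.
Arguments speed {R G} f k j : rename.
Arguments is_tree {R} G.
Arguments total_length {R} G.

Section entropy.
Context {R : realType} {G : metric_graph R}.

(* The point x_j(t) during phase k. *)
Definition tip (f : flooding G) k (j : 'I_(narms f k)) (t : R) : points G :=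
  move_along (arm f k j) (speed f k j * (t - times f k)).

(* [ln 0 = 0], hence 0 * ln 0 = 0. *)
Definition entropy (f : flooding G) : R :=
  - \sum_(k < nphases f) (times f k.+1 - times f k) *
      \sum_(j < narms f k) speed f k j * ln (speed f k j).

Definition from_point : set (flooding G) := [set f | exists v, f 0 = [set v]].

Definition max_entropy : set (flooding G) :=
  [set f | from_point f /\
    (entropy f)%:E = ereal_sup [set (entropy g)%:E | g in from_point]].

End entropy.

(* Main.v *)
From HB Require Import structures.
Require Import Defs.
From mathcomp Require Import all_boot all_order all_algebra.
From mathcomp Require Import generic_quotient.
From mathcomp Require Import all_classical all_reals all_analysis.
From mathcomp Require Import lra.

(** For a tree, a flooding is a continuous analogue of a linear extension and
    the optimal one is an analogue of the hook length formula.  Let the arms at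
    some time have positive lengths x_j of unflooded branches ahead of them, of
    sum T, and let a phase of duration tau advance them by d_j.  The function
    T ln T - sum_j x_j ln x_j is homogeneous and superadditive (log-sum
    inequality), so splitting x = d + (x - d) bounds the entropy of the phase,
    which is tau ln tau - sum_j d_j ln d_j, by the loss of a potential
    T ln T - (sum over the unflooded part of the integral of the logarithm of
    the length beyond), with equality if and only if d is proportional to x.
    The potential telescopes along the edges, so that the supremum over the
    floodings started at v is an explicit function of v, attained by letting
    every arm move at speed x_j / T.  Moving v into a branch of length more
    than half of the total increases this function, by convexity of x ln x. *)

Set Implicit Arguments.
Unset Strict Implicit.
Unset Printing Implicit Defensive.

Import Order.TTheory GRing.Theory Num.Theory.
Import numFieldNormedType.Exports.

Local Open Scope classical_set_scope.
Local Open Scope ring_scope.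

(** * Superadditivity of entropy *)

Section relative_entropy.
Context {R : realType}.
Implicit Types x y : R.

(** A flooding is defined through the outward normal vectors of a set, whereas the entropy estimate
    needs a list of arms with disjoint branches ahead of them. The bridge is the notion of a front,
    which can be recovered from the flooded set because its arms are precisely the outward normal
    vectors; this requires that no arm stand at the end of its edge, so a front is renewed at every
    change of phase. The quantities summed over a front obey a balance law at the vertices and are
    unchanged by renewal, which lets the potential telescope over the phases of an arbitrary
    flooding. An upper bound alone says nothing about a maximiser, as the supremum might be smaller:
    the bound has to be attained from every starting point, hence the construction of a complete
    flooding. Speeds that are constant during a phase suffice for this, because advancing for a time
    s at speeds x_j / T multiplies every x_j by the same factor 1 - s / T. The same observation
    extends the equality case, which is known at the start of each phase, to every time within
    it. *)

Definition xlnx x : R := x * ln x.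

(** The usual [ln s <= s - 1], applied to the square root of [x] and doubled. The quadratic
    remainder makes the equality case of [kl] readable without strict inequalities. *)
Lemma ln_le_sub1_sqrt x : 0 < x -> ln x <= x - 1 - (Num.sqrt x - 1) ^+ 2.
Proof.
move=> x0; have : 0 < Num.sqrt x by rewrite sqrtr_gt0.
have : Num.sqrt x ^+ 2 = x by rewrite sqr_sqrtr// ltW.
move: (Num.sqrt x) => s <- s0; rewrite lnXn//.
have : ln s <= s - 1.
  by have := le_ln1Dx (x := s - 1); rewrite addrCA subrr addr0; apply; lra.
by move: (ln s) => l h; rewrite !expr2 mulr2n; lra.
Qed.

(** The summand of the relative entropy for measures that are not normalised: the terms [- x + y]
    make each summand nonnegative by itself. For positive [y] it is the excess of [xlnx x] over the
    tangent of [xlnx] at [y]. *)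
Definition kl x y : R := xlnx x - x * ln y - x + y.

Lemma kl_ge0 x y : 0 <= x -> 0 < y -> 0 <= kl x y.
Proof.
rewrite le_eqVlt => /predU1P[<-|x0] y0; first by rewrite /kl /xlnx; lra.
have := ln_le_sub1_sqrt (divr_gt0 y0 x0); rewrite ln_div// /kl /xlnx.
have := sqr_ge0 (Num.sqrt (y / x) - 1); set s := _ ^+ 2 => s0 h.
have : x * (ln y - ln x) <= x * (y / x - 1) by rewrite ler_pM2l//; lra.
by rewrite !mulrBr mulrCA divff ?gt_eqF//; lra.
Qed.

Lemma kl_eq0 x y : 0 <= x -> 0 < y -> kl x y = 0 -> x = y.
Proof.
rewrite le_eqVlt => /predU1P[<-|x0] y0; first by rewrite /kl /xlnx; lra.
have := ln_le_sub1_sqrt (divr_gt0 y0 x0); rewrite ln_div// /kl /xlnx.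
have := sqr_ge0 (Num.sqrt (y / x) - 1); set s := _ ^+ 2 => s0 h kl0.
have : x * (ln y - ln x) <= x * (y / x - 1 - s) by rewrite ler_pM2l//; lra.
rewrite !mulrBr [x * (y / x)]mulrCA divff ?gt_eqF// => hh.
have : x * s <= 0 by lra.
rewrite pmulr_rle0// => s_le0.
have /eqP : s = 0 by apply/eqP; rewrite eq_le s_le0.
rewrite sqrf_eq0 subr_eq0 => /eqP h1.
have : y / x = 1 by rewrite -[LHS]sqr_sqrtr ?h1 ?expr1n// ltW// divr_gt0.
by move/divr1_eq.
Qed.

Lemma klxx x : kl x x = 0. Proof. rewrite /kl /xlnx; lra. Qed.

(* The deficit in the superadditivity of the homogeneous concave function
   x |-> xlnx (\sum x) - \sum (xlnx x). *)
Lemma entropy_gap (I : finType) (D : {set I}) (d r : I -> R) (tau rho : R) :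
  0 < tau -> 0 < rho -> (forall i, i \in D -> 0 < d i + r i) ->
  \sum_(i in D) d i = tau -> \sum_(i in D) r i = rho ->
  (xlnx (tau + rho) - \sum_(i in D) xlnx (d i + r i))
  - (xlnx tau - \sum_(i in D) xlnx (d i))
  - (xlnx rho - \sum_(i in D) xlnx (r i)) =
  \sum_(i in D) (kl (d i) (tau * ((d i + r i) / (tau + rho))) +
                 kl (r i) (rho * ((d i + r i) / (tau + rho)))).
Proof.
move=> t0 r0 x0 sd sr; have T0 : 0 < tau + rho by lra.
transitivity (\sum_(i in D) (xlnx (d i) + xlnx (r i) - xlnx (d i + r i)
   + (d i + r i) * ln (tau + rho) - d i * ln tau - r i * ln rho
   - (d i + r i) + (tau + rho) * ((d i + r i) / (tau + rho)))).
  rewrite !big_split /= -!big_distrr /= !sumrN -!big_distrl /=.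
  rewrite !big_split/= sd sr; rewrite divff ?gt_eqF// /xlnx; lra.
apply: eq_bigr => i iD; have xi := x0 _ iD.
rewrite /kl !lnM ?posrE ?divr_gt0// ?invr_gt0// lnV ?posrE//.
have -> : (tau + rho) * ((d i + r i) / (tau + rho)) =
  tau * ((d i + r i) / (tau + rho)) + rho * ((d i + r i) / (tau + rho)) by lra.
by rewrite {3}/xlnx; lra.
Qed.

Lemma entropy_superadditive (I : finType) (D : {set I}) (d r : I -> R) (tau : R) :
  0 < tau -> (forall i, i \in D -> 0 <= d i) -> (forall i, i \in D -> 0 <= r i) ->
  (forall i, i \in D -> 0 < d i + r i) ->
  \sum_(i in D) d i = tau ->
  let T := \sum_(i in D) (d i + r i) in
  let gap := (xlnx T - \sum_(i in D) xlnx (d i + r i))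
    - (xlnx tau - \sum_(i in D) xlnx (d i))
    - (xlnx (T - tau) - \sum_(i in D) xlnx (r i)) in
  0 <= gap /\ (gap = 0 <-> forall i, i \in D -> d i = tau * ((d i + r i) / T)).
Proof.
move=> t0 d0 r0 x0 sd T gap.
have TE : T = tau + \sum_(i in D) r i by rewrite /T big_split/= sd.
have : 0 <= \sum_(i in D) r i by apply: sumr_ge0.
(* [entropy_gap] takes the logarithm of [rho], so the case where nothing is left, as in a final
   phase, is separate: [r] vanishes and the proportionality is trivial. *)
rewrite le_eqVlt => /predU1P[rho0|rho0].
  have ri i : i \in D -> r i = 0.
    move=> iD; apply/eqP; apply: contraTT iD => ri; apply/negP => iD.
    move/esym/eqP: rho0; rewrite psumr_eq0// => /allP/(_ i (mem_index_enum _)).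
    by rewrite iD (negbTE ri).
  have Ti : T = tau by rewrite TE -rho0 addr0.
  have gap0 : gap = 0.
    rewrite /gap Ti subrr (eq_bigr (fun i => xlnx (d i))); last first.
      by move=> i iD; rewrite ri// addr0.
    rewrite [\sum_(i in D) xlnx (r i)]big1; last by move=> i iD; rewrite ri// /xlnx mul0r.
    by rewrite /xlnx; lra.
  rewrite gap0; split=> //; split=> // _ i iD; rewrite ri// addr0 Ti mulrCA divff ?mulr1//.
  by rewrite gt_eqF.
set rho := \sum_(i in D) r i in TE rho0.
have T0 : 0 < T by rewrite TE; lra.
have gapE : gap = \sum_(i in D) (kl (d i) (tau * ((d i + r i) / T)) +
                 kl (r i) (rho * ((d i + r i) / T))).
  rewrite /gap TE -(entropy_gap t0 rho0 x0 sd (erefl _)).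
  by rewrite (_ : tau + rho - tau = rho)//; lra.
have c0 a i : 0 < a -> i \in D -> 0 < a * ((d i + r i) / T).
  by move=> a0 iD; rewrite mulr_gt0// divr_gt0// x0.
have k0 i : i \in D -> 0 <= kl (d i) (tau * ((d i + r i) / T)) +
                 kl (r i) (rho * ((d i + r i) / T)).
  by move=> iD; apply: addr_ge0; apply: kl_ge0; rewrite ?c0// ?d0 ?r0.
rewrite gapE; split; first exact: sumr_ge0.
split.
  move=> /eqP; rewrite psumr_eq0// => /allP h i iD.
  have := h i (mem_index_enum _); rewrite iD/= paddr_eq0 ?kl_ge0 ?c0 ?d0 ?r0//.
  by move=> /andP[/eqP h1 _]; apply: kl_eq0 h1; rewrite ?c0 ?d0.
move=> h; apply: big1 => i iD; have hd := h i iD.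
have hr : r i = rho * ((d i + r i) / T).
  have : (tau + rho) * ((d i + r i) / T) = d i + r i.
    by rewrite -TE mulrCA divff ?mulr1// gt_eqF.
  by rewrite mulrDl -hd; lra.
by rewrite -hd -hr !klxx addr0.
Qed.

End relative_entropy.

(** * Darts of a tree *)

Section darts.
Context {R : realType} {G : metric_graph R}.

(* The direction [true] is the one of the orientation of the edge. *)
Definition dart : Type := (edge G * bool)%type.
HB.instance Definition _ := Finite.on dart.

Implicit Types (g h : dart) (e : edge G) (x y : vertex G).

Definition tl h := if h.2 then src h.1 else tgt h.1.
Definition hd h := if h.2 then tgt h.1 else src h.1.
Definition opp h : dart := (h.1, ~~ h.2).

Lemma oppK : involutive opp.
Proof. by case=> e b; rewrite /opp/= negbK. Qed.

Lemma tl_opp h : tl (opp h) = hd h.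
Proof. by case: h => e []. Qed.

Lemma hd_opp h : hd (opp h) = tl h.
Proof. by case: h => e []. Qed.

Lemma tl_neq_hd h : tl h != hd h.
Proof. by case: h => e []; rewrite /tl/hd/= ?no_loop// eq_sym no_loop. Qed.

Lemma dart_eqP g h : g.1 = h.1 -> g = h \/ g = opp h.
Proof. by case: g h => e [] [e' []] /= ->; [left|right|right|left]. Qed.

Lemma opp_neq h : opp h != h.
Proof. by case: h => e []; rewrite /opp/= xpair_eqE eqxx. Qed.

Definition joined : rel (vertex G) := [rel x y | [exists g, (tl g == x) && (hd g == y)]].

Lemma joinedE : joined =2 Defs.adjacent (@src _ G) (@tgt _ G).
Proof.
move=> x y; apply/existsP/existsP.
  move=> [[e []] /andP[/eqP<- /eqP<-]]; exists e; rewrite /tl/hd/= eqxx//.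
  by rewrite orbT.
move=> [e /orP[/eqP[<- <-]|/eqP[<- <-]]]; first by exists (e, true); rewrite !eqxx.
by exists (e, false); rewrite !eqxx.
Qed.

Definition cut e : rel (vertex G) :=
  [rel x y | [exists g, [&& g.1 != e, tl g == x & hd g == y]]].

Lemma cut_sym e : symmetric (cut e).
Proof.
suff h x y : cut e x y -> cut e y x by move=> x y; apply/idP/idP; apply: h.
move=> /existsP[g /and3P[ge gx gy]]; apply/existsP; exists (opp g).
by rewrite tl_opp hd_opp gx gy ge.
Qed.

Lemma cut_csym e : connect_sym (cut e).
Proof. exact/sym_connect_sym/cut_sym. Qed.

Lemma cutP e g : g.1 != e -> cut e (tl g) (hd g).
Proof. by move=> ge; apply/existsP; exists g; rewrite ge !eqxx. Qed.

Definition side h : {set vertex G} := [set x | connect (cut h.1) (hd h) x]%SET.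

(** Once the edge of [h] is excluded, both ends of an edge lie on the same side of [h], so testing
    [src e] introduces no asymmetry. *)
Definition beyond h : {set edge G} := [set e | (e != h.1) && (src e \in side h)]%SET.

Lemma beyondE h e : (e \in beyond h) = (e != h.1) && (src e \in side h).
Proof. by rewrite /beyond finset.inE. Qed.

Lemma hd_side h : hd h \in side h.
Proof. by rewrite inE connect0. Qed.

Lemma tl_side_opp h : tl h \in side (opp h).
Proof. by rewrite -hd_opp hd_side. Qed.

Lemma side_cut h x y : cut h.1 x y -> (x \in side h) = (y \in side h).
Proof. by move=> xy; rewrite !inE; apply: (same_connect_r (@cut_csym _) (connect1 xy)). Qed.

Lemma side_ends g h : g.1 != h.1 -> (tl g \in side h) = (hd g \in side h).
Proof. by move=> gh; apply/side_cut/cutP. Qed.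

Lemma beyond_tl g h : g.1 != h.1 -> (g.1 \in beyond h) = (tl g \in side h).
Proof.
move=> gh; rewrite beyondE gh/=; case: g gh => e [] gh//.
by rewrite (@side_ends (e, false)).
Qed.

Lemma beyond_hd g h : g.1 != h.1 -> (g.1 \in beyond h) = (hd g \in side h).
Proof. by move=> gh; rewrite beyond_tl// side_ends. Qed.

Lemma beyond_neq e h : e \in beyond h -> e != h.1.
Proof. by rewrite beyondE => /andP[]. Qed.

Lemma beyond_self h : h.1 \notin beyond h.
Proof. by rewrite beyondE eqxx. Qed.

Lemma side_ind (P : vertex G -> Prop) h :
  P (hd h) ->
  (forall g, g.1 != h.1 -> tl g \in side h -> hd g \in side h ->
     P (tl g) -> P (hd g)) ->
  forall x, x \in side h -> P x.
Proof.
move=> P0 Pstep x; rewrite inE => /connectP[p]; move: (hd_side h).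
elim: p (hd h) P0 => [|y p IH] z Pz zs /=; first by move=> _ ->.
move=> /andP[zy yp] xl; have ys : y \in side h by rewrite -(side_cut zy).
apply: (IH y) => //.
by case/existsP: zy => g /and3P[gh /eqP gz /eqP gy]; subst; apply: Pstep.
Qed.

Hypothesis tree : is_tree G.

(** A simple path from the head of [h] back to its tail that avoids the edge of [h] is closed by [h]
    into a cycle, so acyclicity leaves at most two vertices on it. One vertex would make [h] a loop,
    two would give an edge parallel to [h]. *)
Lemma tl_notin_side h : tl h \notin side h.
Proof.
rewrite inE; apply/negP => /connectP[p hp]; case/shortenP: hp => {}p hp up _ tlE.
have adjp : path joined (hd h) p.
  apply: sub_path hp => x y /existsP[g /and3P[_ gx gy]].
  by apply/existsP; exists g; rewrite gx gy.
have := tree up; rewrite /cycle rcons_path (eq_path (e' := joined)); last first.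
  by move=> x y; rewrite joinedE.
rewrite adjp -tlE -joinedE /=.
have -> : joined (tl h) (hd h) by apply/existsP; exists h; rewrite !eqxx.
move=> /(_ isT).
case: p hp {up adjp} tlE => [|x [|y p]]//= hp tlE _.
  by have := tl_neq_hd h; rewrite tlE eqxx.
move: hp; rewrite -tlE andbT => /existsP[g /and3P[/negP gh /eqP gt /eqP gd]].
apply: gh; apply/eqP/no_multi_edge.
case: g h gt gd {tlE} => e [] [e' []]; rewrite /tl/hd/= => -> ->; by [left|right].
Qed.

Lemma hd_notin_side_opp h : hd h \notin side (opp h).
Proof. by rewrite -tl_opp tl_notin_side. Qed.

Lemma side_opp h x : (x \in side (opp h)) = (x \notin side h).
Proof.
suff cover : (x \in side h) || (x \in side (opp h)).
  case xh : (x \in side h) cover => //= _; apply/negP => xo.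
  have := tl_notin_side h; rewrite inE; move: xh xo; rewrite !inE/= => xh.
  rewrite cut_csym => xo; rewrite (connect_trans xh)//.
  by rewrite hd_opp in xo.
have /connectP[p] := graph_connected (hd h) x.
rewrite -(eq_path joinedE).
have : (hd h \in side h) || (hd h \in side (opp h)) by rewrite hd_side.
elim: p (hd h) => [|y p IH] z /=; first by move=> ? _ ->.
move=> zs /andP[zy yp]; apply: IH => //.
case/existsP: zy => g /andP[/eqP gz /eqP gy]; subst.
have [/dart_eqP[]->|gh] := eqVneq g.1 h.1; first by rewrite hd_side.
  by rewrite hd_side orbT.
by rewrite -!side_ends.
Qed.

Lemma beyond_opp h e : e != h.1 -> (e \in beyond (opp h)) = (e \notin beyond h).
Proof. by move=> eh; rewrite !beyondE eh/= side_opp. Qed.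

(** The two hypotheses say that [g] lies past [h] and points away from it. A walk from the head of
    [g] that avoids the edge of [g] can then never use the edge of [h]. *)
Lemma side_sub g h : g.1 \in beyond h -> h.1 \notin beyond g -> side g \subset side h.
Proof.
move=> gh hg; apply/fintype.subsetP; have ghN := beyond_neq gh.
apply: side_ind => [|k kg tk _ IH]; first by rewrite -beyond_hd.
rewrite -side_ends//; apply/eqP => kh; move: hg.
by rewrite -kh beyond_tl// tk.
Qed.

Lemma beyond_sub g h : g.1 \in beyond h -> h.1 \notin beyond g -> beyond g \subset beyond h.
Proof.
move=> gh hg; apply/fintype.subsetP => e eg; rewrite beyondE; apply/andP; split.
  by apply: contraNneq hg => <-.
by move: eg; rewrite beyondE => /andP[_]; apply/fintype.subsetP/side_sub.
Qed.

Definition next h : {set dart} := [set g | (tl g == hd h) && (g.1 != h.1)]%SET.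

Section next.
Context g h (gh : g \in next h).

Lemma next_tl : tl g = hd h.
Proof. by move: gh; rewrite inE => /andP[/eqP]. Qed.

Lemma next_neq : g.1 != h.1.
Proof. by move: gh; rewrite inE => /andP[]. Qed.

Lemma next_beyond : g.1 \in beyond h.
Proof. by rewrite beyond_tl ?next_neq// next_tl hd_side. Qed.

Lemma next_notbeyond : h.1 \notin beyond g.
Proof. by rewrite beyond_hd 1?eq_sym ?next_neq// -next_tl tl_notin_side. Qed.

Lemma next_sub_beyond : beyond g \subset beyond h.
Proof. by apply: beyond_sub; [apply: next_beyond|apply: next_notbeyond]. Qed.

End next.

Lemma fork_neq g h : tl g = tl h -> g != h -> g.1 != h.1.
Proof.
move=> gh; apply: contra_neq => /dart_eqP[//|ge].
by move: gh (tl_neq_hd h); rewrite ge tl_opp => ->; rewrite eqxx.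
Qed.

Lemma fork_notbeyond g h : tl g = tl h -> g.1 \notin beyond h.
Proof.
have [->|gh gt] := eqVneq g h; first by rewrite beyond_self.
by rewrite beyond_tl ?fork_neq// gt tl_notin_side.
Qed.

Lemma fork_beyond_opp g h : tl g = tl h -> g != h -> g.1 \in beyond (opp h).
Proof. by move=> gt gh; rewrite beyond_opp ?fork_notbeyond// fork_neq. Qed.

Lemma fork_sub g h : tl g = tl h -> g != h -> beyond g \subset beyond (opp h).
Proof.
move=> gt gh; apply: beyond_sub; first exact: fork_beyond_opp.
exact: (fork_notbeyond (esym gt)).
Qed.

Lemma next_cover h e : e \in beyond h ->
  exists2 g, g \in next h & (e == g.1) || (e \in beyond g).
Proof.
move=> eh; have ehN := beyond_neq eh.
have : src e = hd h \/ exists2 g, g \in next h & src e \in side g.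
  move: eh; rewrite beyondE ehN/=; move: (src e); apply: side_ind; first by left.
  move=> k kh _ _ [kt|[g gh kg]].
    by right; exists k; [rewrite inE kt eqxx|apply: hd_side].
  have [/dart_eqP[kE|kE]|kgN] := eqVneq k.1 g.1.
  - by move: kg; rewrite kE (negbTE (tl_notin_side g)).
  - by left; rewrite kE hd_opp (next_tl gh).
  - by right; exists g; rewrite -?side_ends.
case=> [eE|[g gh eg]].
  by exists (e, true); rewrite ?eqxx// inE /tl/= eE eqxx.
by exists g => //; rewrite beyondE eg andbT orbN.
Qed.

Lemma next_disjoint h g k e : g \in next h -> k \in next h ->
  (e == g.1) || (e \in beyond g) -> (e == k.1) || (e \in beyond k) -> g = k.
Proof.
move=> gh kh; have gk : tl g = tl k by rewrite !(@next_tl _ h).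
move=> eg ek; apply/eqP/negPn/negP => gkN.
have eo : e \in beyond (opp k).
  case/orP: eg => [/eqP->|]; first exact: fork_beyond_opp.
  by apply/fintype.subsetP/fork_sub.
case/orP: ek => [/eqP ek|ek].
  by have := beyond_self (opp k); rewrite /= -ek eo.
by move: eo; rewrite beyond_opp ?ek// beyond_neq.
Qed.

(** In a tree each edge beyond [h] is reached through exactly one dart of [next h]. This is the
    recursion by which masses and costs pass from an arm to its successors at a vertex. *)
Lemma sum_beyond (F : edge G -> R) h :
  \sum_(e in beyond h) F e = \sum_(g in next h) (F g.1 + \sum_(e in beyond g) F e).
Proof.
transitivity (\sum_(e in beyond h)
    \sum_(g in next h | (e == g.1) || (e \in beyond g)) F e).
  apply: eq_bigr => e eh; have [g gh eg] := next_cover eh.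
  rewrite (big_pred1 g)// => k /=; apply/andP/eqP => [[kh ek]|->//].
  exact: next_disjoint kh gh ek eg.
rewrite (exchange_big_dep (fun g => g \in next h))/=; last by move=> ? ? _ /andP[].
apply: eq_bigr => g gh.
rewrite (bigD1 g.1)/=; last by rewrite next_beyond// gh eqxx.
congr (_ + _); apply: eq_bigl => e; rewrite gh/=.
have [->|] := eqVneq e g.1; first by rewrite (negbTE (beyond_self g)) !andbF.
move=> _; rewrite andbT/=; case eg : (e \in beyond g); rewrite ?andbF//.
by rewrite (fintype.subsetP (next_sub_beyond gh)).
Qed.

Definition mass h : R := \sum_(e in beyond h) len e.

(* The dart carried by e which points away from e0. *)
Definition away (e0 e : edge G) : dart := (e, src e0 \notin side (e, true)).

(** The integral of [ln + 1] of the length beyond, along the edge of [h]: [xlnx] is a primitive of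
    [ln + 1], and that length runs from [len h.1 + mass h] down to [mass h]. *)
Definition xlnx_drop h : R := xlnx (len h.1 + mass h) - xlnx (mass h).

Definition tail_cost h : R := \sum_(e in beyond h) xlnx_drop (away h.1 e).

Lemma away_next g h : g \in next h -> away h.1 g.1 = g.
Proof.
move=> gh; rewrite /away.
have := @beyond_tl (h.1, true) (g.1, true).
have := @beyond_hd h (g.1, true).
rewrite /= eq_sym next_neq// => -> // <- //.
rewrite -(next_tl gh); case: g {gh} => e [] /=.
  by rewrite tl_notin_side.
by rewrite tl_side_opp.
Qed.

(** Removing [e] leaves the edges of [h] and [g] on the same side, since they share the vertex
    [hd h]. Hence the cost of an edge does not depend on which of the two arms it is seen from. *)
Lemma away_beyond g h e : g \in next h -> e \in beyond g -> away h.1 e = away g.1 e.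
Proof.
move=> gh eg; congr pair; congr negb.
have ge : g.1 != e by rewrite eq_sym beyond_neq.
have he : h.1 != e.
  by rewrite eq_sym beyond_neq// (fintype.subsetP (next_sub_beyond gh)).
have -> : (src h.1 \in side (e, true)) = (hd h \in side (e, true)).
  by rewrite -(@beyond_hd h (e, true))// (@beyond_tl (h.1, true) (e, true)).
rewrite -(next_tl gh) -(@beyond_tl g (e, true))//.
by rewrite (@beyond_tl (g.1, true) (e, true)).
Qed.

Lemma mass_next h : mass h = \sum_(g in next h) (len g.1 + mass g).
Proof. exact: sum_beyond. Qed.

Lemma tail_cost_next h :
  tail_cost h = \sum_(g in next h) (xlnx_drop g + tail_cost g).
Proof.
rewrite /tail_cost sum_beyond; apply: eq_bigr => g gh.
rewrite away_next//; congr (_ + _); apply: eq_bigr => e eg.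
by rewrite (away_beyond gh).
Qed.

Lemma mass_ge0 h : 0 <= mass h.
Proof. by apply: sumr_ge0 => e _; apply/ltW/len_gt0. Qed.

Lemma mass_opp h : len h.1 + mass h + mass (opp h) = total_length G.
Proof.
rewrite /total_length (bigD1 h.1)//= -addrA; congr (_ + _).
rewrite (bigID (fun e => e \in beyond h))/=; congr (_ + _); apply: eq_bigl => e.
  by rewrite beyondE; case: (e == h.1).
have [->|eh] := eqVneq e h.1; first by have /negbTE-> := beyond_self (opp h).
rewrite /=.
by rewrite beyond_opp.
Qed.

End darts.
Arguments dart {R} G.

(** * Branches *)

Section dart_points.
Context {R : realType} {G : metric_graph R}.
Implicit Types (g h : dart G) (e : edge G) (u s t : R) (x y : vertex G).

Definition dart_coord h u : R := if h.2 then u else len h.1 - u.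

(* The point at distance u from the tail of h. *)
Definition dpt h u : points G := pt h.1 (dart_coord h u).

Lemma dart_coord_bound h u : (0 <= dart_coord h u <= len h.1) = (0 <= u <= len h.1).
Proof. by case: h => e []//=; rewrite /dart_coord/=; apply/idP/idP; lra. Qed.

Lemma dpt_opp h u : dpt (opp h) (len h.1 - u) = dpt h u.
Proof.
rewrite /dpt /dart_coord /=; case: h.2 => //=.
by rewrite (_ : len h.1 - (len h.1 - u) = u)//; lra.
Qed.

Lemma dptP (p : points G) : exists h u, 0 <= u <= len h.1 /\ p = dpt h u.
Proof. by have [e [x [hx ->]]] := ptP p; exists (e, true), x. Qed.

Definition at_vertex h u x : Prop := (u = 0 /\ tl h = x) \/ (u = len h.1 /\ hd h = x).

Lemma vertex_of_dart h u x : 0 <= u <= len h.1 ->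
  vertex_of (raw h.1 (dart_coord h u)) = Some x <-> at_vertex h u x.
Proof.
move=> hu; case: h hu => e b /= hu; have l0 := len_gt0 e.
rewrite /at_vertex /tl /hd /dart_coord /=.
have [u0|/eqP u0] := eqVneq u 0.
  have -> : vertex_of (raw e (if b then u else len e - u)) =
      Some (if b then src e else tgt e).
    by rewrite u0 subr0; case: b; rewrite ?vertex_of_src ?vertex_of_tgt.
  split=> [[->]|[[_ ->]|[ul _]]]//; first by left.
  by exfalso; lra.
have [ul|/eqP ul] := eqVneq u (len e).
  have -> : vertex_of (raw e (if b then u else len e - u)) =
      Some (if b then tgt e else src e).
    by rewrite ul subrr; case: b; rewrite ?vertex_of_src ?vertex_of_tgt.
  by split=> [[->]|[[//]|[_ ->]]]//; right.
split=> [|[[//]|[//]]].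
rewrite /vertex_of /= clampE; last by case: b; lra.
case: eqP => [h1 _|_]; first by exfalso; case: b h1; lra.
by case: eqP => [h1 _|//]; exfalso; case: b h1; lra.
Qed.

Lemma dpt_eqP g s h t : 0 <= s <= len g.1 -> 0 <= t <= len h.1 ->
  dpt g s = dpt h t <-> (g.1 = h.1 /\ dart_coord g s = dart_coord h t) \/
    exists2 x, at_vertex g s x & at_vertex h t x.
Proof.
move=> hs ht; split.
  rewrite /dpt /pt => /eqquotP; rewrite /= /same_point => /orP[/eqP/(congr1 val)|].
    by rewrite /= !clampE ?dart_coord_bound// => -[-> ->]; left.
  case E : (vertex_of (raw g.1 _)) => [x|]//= /eqP/esym E'.
  by right; exists x; apply/vertex_of_dart.
case=> [[gh ct]|[x /(vertex_of_dart _ hs) gx /(vertex_of_dart _ ht) hx]].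
  by rewrite /dpt gh ct.
by apply/eqquotP; rewrite /= /same_point gx hx eqxx orbT.
Qed.

Lemma dpt_inj h s t : 0 <= s <= len h.1 -> 0 <= t <= len h.1 ->
  dpt h s = dpt h t -> s = t.
Proof.
move=> hs ht /(dpt_eqP hs ht) [[_]|[x]].
  by rewrite /dart_coord; case: h.2 => //; lra.
have /eqP nl := tl_neq_hd h.
by move=> [[-> <-]|[-> <-]] [[-> ]|[-> ]] // /esym.
Qed.

Lemma dpt_next g h : tl g = hd h -> dpt g 0 = dpt h (len h.1).
Proof.
move=> gh; apply/dpt_eqP; rewrite ?lexx ?ltW ?len_gt0//.
by right; exists (hd h); [left|right].
Qed.

(** The far end of a dart is the starting point of the opposite dart. *)
Lemma dptP_lt (p : points G) : exists h u, 0 <= u < len h.1 /\ p = dpt h u.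
Proof.
have [h [u [/andP[u0 ul] ->]]] := dptP p.
have [ult|ulen] := ltP u (len h.1); first by exists h, u; rewrite u0 ult.
exists (opp h), 0; rewrite lexx len_gt0; split=> //.
rewrite -[RHS]dpt_opp oppK/= subr0; congr dpt; lra.
Qed.

(** The closed branch keeps its starting point. It is a finite union of segments, hence closed, and
    in a tree the open branch is the complement of the opposite closed branch ([branchE]), hence
    open. *)
Definition cbranch h u : set (points G) := [set p |
  (exists2 s, u <= s <= len h.1 & p = dpt h s) \/
  (exists g s, [/\ g.1 \in beyond h, 0 <= s <= len g.1 & p = dpt g s])].

Definition branch h u : set (points G) := cbranch h u `\ dpt h u.

Hypothesis tree : is_tree G.

Lemma cbranch_cover h u p : 0 <= u <= len h.1 ->
  cbranch h u p \/ cbranch (opp h) (len h.1 - u) p.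
Proof.
move=> hu; have [g [s [hs ->]]] := dptP p.
have [gh|gh] := eqVneq g.1 h.1.
  have [t ht ->] : exists2 t, 0 <= t <= len h.1 & dpt g s = dpt h t.
    have [gE|gE] := dart_eqP gh; first by exists s; rewrite -?gE.
    exists (len h.1 - s); first by move: hs; rewrite gh; lra.
    by rewrite gE -dpt_opp oppK.
  have [ut|tu] := leP u t; first by left; left; exists t => //; lra.
  right; left; exists (len h.1 - t); first by rewrite /=; lra.
  by rewrite dpt_opp.
case gb : (g.1 \in beyond h); first by left; right; exists g, s.
by right; right; exists g, s; rewrite beyond_opp// gb.
Qed.

Lemma at_vertex_beyond g s h x : g.1 \in beyond h -> at_vertex g s x -> x \in side h.
Proof.
move=> gb; have gh := beyond_neq gb.
by move=> [[_ <-]|[_ <-]]; [rewrite -beyond_tl|rewrite -beyond_hd].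
Qed.

Lemma cbranch_cap h u p : 0 <= u <= len h.1 ->
  cbranch h u p -> cbranch (opp h) (len h.1 - u) p -> p = dpt h u.
Proof.
move=> hu.
(* The mixed case, with one description along the edge of [k] and the other behind it: the common
   vertex can only be the tail of [k]. It is used for [h] and for [opp h]. *)
have half k v q : 0 <= v <= len k.1 -> (exists2 s, v <= s <= len k.1 & q = dpt k s) ->
    (exists g s, [/\ g.1 \in beyond (opp k), 0 <= s <= len g.1 & q = dpt g s]) ->
    q = dpt k v.
  move=> hv [s hs ->] [g [t [gb ht]]].
  have gk := beyond_neq gb.
  case/dpt_eqP => //; first lra; first by move=> [kg _]; rewrite -kg eqxx in gk.
  move=> [x kx /at_vertex_beyond]/(_ _ gb) xo.
  case: kx => [[s0 _]|[_ hx]]; first by congr dpt; lra.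
  by move: xo; rewrite -hx (negbTE (hd_notin_side_opp tree k)).
move=> [[s hs ps]|pb] [[t ht pt]|pb'].
- move: pt; rewrite -[t](subKr (len h.1)) dpt_opp ps => /dpt_inj.
  by move=> stE; congr dpt; rewrite /= in ht; have := stE _ _; lra.
- by apply: half hu _ pb'; exists s.
- rewrite -dpt_opp; apply: half => /=; first lra.
    by exists t.
  by rewrite oppK.
- case: pb pb' => [g [s [gb hs ->]]] [k [t [kb ht]]].
  have gh := beyond_neq gb; have kh := beyond_neq kb.
  case/dpt_eqP => // [[gk _]|[x /at_vertex_beyond - /(_ _ gb) xh]].
    by move: kb; rewrite -gk beyond_opp// gb.
  by move=> /at_vertex_beyond - /(_ _ kb); rewrite side_opp// xh.
Qed.

Lemma cbranch_self h u : 0 <= u <= len h.1 -> cbranch h u (dpt h u).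
Proof. by move=> hu; left; exists u => //; rewrite lexx; lra. Qed.

Lemma branchE h u : 0 <= u <= len h.1 -> branch h u = ~` cbranch (opp h) (len h.1 - u).
Proof.
move=> hu; apply/seteqP; split=> p.
  by move=> [ph pu] po; apply: pu; apply: cbranch_cap ph po.
move=> po; have [ph|//] := cbranch_cover p hu; split=> // pu; apply: po.
by rewrite pu -dpt_opp; apply: cbranch_self => /=; lra.
Qed.

Lemma cbranch_sub h u v : 0 <= u <= v -> cbranch h v `<=` cbranch h u.
Proof.
move=> uv p [[s hs ->]|pb]; last by right.
by left; exists s => //; lra.
Qed.

Lemma branch_sub h u v : 0 <= u <= v -> v <= len h.1 -> branch h v `<=` branch h u.
Proof.
move=> uv vl; rewrite !branchE; try lra; apply: subsetC.
by apply: cbranch_sub; lra.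
Qed.

Lemma branch_dpt h u s : 0 <= u -> u < s -> s <= len h.1 -> branch h u (dpt h s).
Proof.
move=> u0 us sl; split; first by left; exists s => //; lra.
by move=> /dpt_inj; lra.
Qed.

Lemma branch_beyond h u g s : 0 <= u < len h.1 -> g.1 \in beyond h ->
  0 <= s <= len g.1 -> branch h u (dpt g s).
Proof.
move=> hu gb hs; split; first by right; exists g, s.
move=> /dpt_eqP[]//; first lra.
  by move=> [gh _]; move: (beyond_neq gb); rewrite gh eqxx.
move=> [x /at_vertex_beyond - /(_ _ gb) xh [[_ tx]|[ul _]]]; last lra.
by move: xh; rewrite -tx (negbTE (tl_notin_side tree h)).
Qed.

Lemma branch_dartP h u s : 0 <= u <= len h.1 -> 0 <= s <= len h.1 ->
  branch h u (dpt h s) <-> u < s.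
Proof.
move=> hu hs; split; last by move=> us; apply: branch_dpt; lra.
rewrite branchE// => sN; rewrite ltNge; apply/negP => su; apply: sN.
by rewrite -dpt_opp; left; exists (len h.1 - s) => //=; lra.
Qed.

Lemma branch_oppP h u s : 0 <= u <= len h.1 -> 0 <= s <= len h.1 ->
  branch (opp h) u (dpt h s) <-> u < len h.1 - s.
Proof. by move=> hu hs; rewrite -dpt_opp; apply: (@branch_dartP (opp h)) => //=; lra. Qed.

Lemma branch_otherP h u g s : 0 <= u < len h.1 -> 0 <= s <= len g.1 -> g.1 != h.1 ->
  branch h u (dpt g s) <-> g.1 \in beyond h.
Proof.
move=> hu hs gh; split; last by move=> gb; apply: branch_beyond.
rewrite branchE; last lra.
by move=> sN; apply/negPn/negP => gb; apply: sN; right; exists g, s; rewrite beyond_opp.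
Qed.

Lemma branch_split h u v p : 0 <= u <= v -> v <= len h.1 ->
  branch h u p <-> branch h v p \/ exists2 s, u < s <= v & p = dpt h s.
Proof.
move=> uv vl; split; last first.
  case=> [|[s hs ->]]; first exact: branch_sub.
  by apply: branch_dpt; lra.
move=> [pu pN].
have [pv|pv] := EM (p = dpt h v).
  right; exists v => //; rewrite lexx andbT lt_neqAle; case/andP: uv => _ ->; rewrite andbT.
  by apply/eqP => uv'; apply: pN; rewrite uv'.
case: pu => [[s hs ps]|pb]; last by left; split=> //; right.
have [sv|vs] := leP s v.
  right; exists s => //; rewrite sv andbT lt_neqAle; case/andP: hs => -> _; rewrite andbT.
  by apply/eqP => us; apply: pN; rewrite us.
by left; split => //; left; exists s => //; lra.
Qed.

(** This is what allows an arm to be replaced at a vertex by the darts leaving it. At a leaf both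
    sides are empty. *)
Lemma branch_end h p :
  branch h (len h.1) p <-> exists2 g, g \in next h & branch g 0 p.
Proof.
have l0 := len_gt0 h.1; split.
  move=> [[[s hs ->] sN|[k [s [kb hs ps]]] pN]].
    by exfalso; apply: sN; congr dpt; lra.
  have [g gh kg] := next_cover tree kb; exists g => //; split; last first.
    by rewrite (dpt_next (next_tl gh)).
  case/orP: kg => [/eqP kg|kg]; last by right; exists k, s.
  left; have [kE|kE] := dart_eqP kg; first by exists s; rewrite -?kE.
  exists (len g.1 - s); first by rewrite -kg; lra.
  by rewrite ps kE -dpt_opp oppK /=.
move=> [g gh [pg pN]]; split; last by rewrite -(dpt_next (next_tl gh)).
right; case: pg => [[s hs ->]|[k [s [kb hs ->]]]].
  by exists g, s; rewrite next_beyond.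
by exists k, s; rewrite (fintype.subsetP (next_sub_beyond tree gh)).
Qed.

Lemma fork_branch_disjoint g h p : tl g = tl h -> g != h ->
  branch g 0 p -> branch h 0 p -> False.
Proof.
move=> gh gN; have l0 := len_gt0 h.1.
rewrite (@branchE h); last by rewrite lexx ltW.
move=> [pg _]; apply; rewrite subr0; right.
case: pg => [[s hs ->]|[k [s [kb hs ->]]]].
  by exists g, s; rewrite fork_beyond_opp.
by exists k, s; rewrite (fintype.subsetP (fork_sub tree gh gN)).
Qed.

Lemma branch_opp_disjoint h u p : 0 <= u <= len h.1 ->
  branch h u p -> branch (opp h) (len h.1 - u) p -> False.
Proof. by move=> hu; rewrite branchE// => po [/po]. Qed.

Lemma branch_opp_cover h u p : 0 <= u <= len h.1 -> p <> dpt h u ->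
  branch h u p \/ branch (opp h) (len h.1 - u) p.
Proof.
move=> hu pN; have [ph|po] := cbranch_cover p hu; first by left.
by right; split=> //; rewrite dpt_opp.
Qed.

Lemma branch_self h u : ~ branch h u (dpt h u).
Proof. by move=> [_]; apply. Qed.

End dart_points.

(** * Topology and length of branches *)

Section branch_topology.
Context {R : realType} {G : metric_graph R}.
Implicit Types (g h : dart G) (e : edge G) (u s t : R) (x y : vertex G).

Lemma pt_clamp e (x : R) : pt e (clamp e x) = pt e x.
Proof.
rewrite /pt (_ : raw e (clamp e x) = raw e x)//; apply: val_inj => /=.
by rewrite (clampE (clampP e x)).
Qed.

Lemma dist_pt e (x y : R) : dist (pt e x) (pt e y) <= `|x - y|.
Proof.
rewrite -(pt_clamp e x) -(pt_clamp e y).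
apply: le_trans (dist_le (walk_edge (clampP e x) (clampP e y))) _.
have l0 := len_gt0 e; rewrite /clamp.
have h1 := ler_norm (x - y); have h2 := ler_norm (y - x).
rewrite (distrC y) in h2; rewrite ler_norml.
move: h1 h2; move: `|x - y| => n h1 h2; rewrite !minElt !maxElt.
by case: (ltP x (len e)) => ?; case: (ltP y (len e)) => ?;
  repeat case: ltP => ?; apply/andP; split; lra.
Qed.

Lemma dpt_continuous h : continuous (dpt h).
Proof.
move=> u; apply/cvg_ballP => d d0; near=> v.
rewrite ballEmdist /=; apply: le_lt_trans (dist_pt _ _ _) _.
have -> : `|dart_coord h u - dart_coord h v| = `|u - v|.
  rewrite /dart_coord; case: h.2 => //.
  by rewrite -normrN; congr `|_|; lra.
near: v; exact: (nbhsx_ballx u d d0).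
Unshelve. all: by end_near.
Qed.

Lemma dpt_segment_connected h (a b : R) : connected (dpt h @` `[a, b]).
Proof.
apply: connected_continuous_connected; first exact: segment_connected.
exact/continuous_subspaceT/dpt_continuous.
Qed.

Lemma dpt_segment_closed h (a b : R) : closed (dpt h @` `[a, b]).
Proof.
apply: compact_closed; first exact: metric_hausdorff.
apply: continuous_compact; last exact: segment_compact.
exact/continuous_subspaceT/dpt_continuous.
Qed.

Lemma cbranch_closed h u : closed (cbranch h u).
Proof.
pose F g : set (points G) :=
  if g.1 \in beyond h then dpt g @` `[0, len g.1] else set0.
have -> : cbranch h u = dpt h @` `[u, len h.1] `|`
    \big[setU/set0]_(g <- index_enum (dart G)) F g.
  rewrite -bigcup_seq; apply/seteqP; split=> p.
    case=> [[s hs ->]|[g [s [gb hs ->]]]].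
      by left; exists s => //; rewrite /= in_itv.
    right; exists g; first by rewrite /= mem_index_enum.
    by rewrite /F gb; exists s => //; rewrite /= in_itv.
  case=> [[s /= hs <-]|[g _]]; first by left; exists s => //; move: hs; rewrite in_itv.
  rewrite /F; case: ifP => // gb [s /= hs <-]; right; exists g, s.
  by move: hs; rewrite in_itv.
apply: closedU; first exact: dpt_segment_closed.
apply: closed_bigsetU => g _; rewrite /F; case: ifP => _; last exact: closed0.
exact: dpt_segment_closed.
Qed.

Hypothesis tree : is_tree G.

Lemma branch_open h u : 0 <= u <= len h.1 -> open (branch h u).
Proof. by move=> hu; rewrite branchE//; apply/closed_openC/cbranch_closed. Qed.

(** Away from its starting point a branch is both open and closed, being cut out there by the closed
    branch. *)
Lemma connected_sub_branch h u (A : set (points G)) p : 0 <= u <= len h.1 ->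
  connected A -> ~ A (dpt h u) -> A p -> branch h u p -> A `<=` branch h u.
Proof.
move=> hu cA Au Ap hp; suff <- : A `&` branch h u = A by apply: subIsetr.
apply: cA; first by exists p.
  by exists (branch h u) => //; apply: branch_open.
exists (cbranch h u); first exact: cbranch_closed.
apply/seteqP; split=> q [Aq hq]; split=> //; first by case: hq.
by split=> // qE; apply: Au; rewrite -qE.
Qed.

(** Every point of the branch is joined inside it to the head [c] of [h]: vertices by walking
    through [side h], other points by sliding along their edge. *)
Lemma branch_connected h u : 0 <= u < len h.1 -> connected (branch h u).
Proof.
move=> hu; have l0 := len_gt0 h.1.
pose c := dpt h (len h.1); pose K := connected_component (branch h u).
have seg g s t : s <= t -> dpt g @` `[s, t] `<=` branch h u -> K (dpt g s) (dpt g t).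
  move=> st sub; have := @connected_component_max _ _ _ (dpt g s) _ sub.
  apply; [by exists s => //; rewrite /= in_itv/= lexx st|exact: dpt_segment_connected|].
  by exists t => //; rewrite /= in_itv/= lexx st.
have edgeK g s t : g.1 \in beyond h -> 0 <= s -> s <= t -> t <= len g.1 -> K (dpt g s) (dpt g t).
  move=> gb s0 st tl; apply: seg => // _ [r /= + <-]; rewrite in_itv/= => hr.
  by apply: branch_beyond => //; lra.
have vertexK x : x \in side h -> forall g s, 0 <= s <= len g.1 -> at_vertex g s x ->
    K c (dpt g s).
  move: x; apply: side_ind => [|k kh tk hk IH] g s hs gx.
    have -> : dpt g s = c.
      by apply/dpt_eqP => //; [lra|right; exists (hd h) => //; right].
    by apply: connected_component_refl; apply: branch_dpt; lra.
  have lk := len_gt0 k.1.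
  apply: connected_component_trans (IH k 0 _ _) _; [lra|by left|].
  have -> : dpt g s = dpt k (len k.1).
    by apply/dpt_eqP => //; [lra|right; exists (hd k) => //; right].
  by apply: edgeK; rewrite ?beyond_tl//; lra.
suff -> : branch h u = K c by apply: component_connected.
apply/seteqP; split; last exact: connected_component_sub.
move=> p [[[s hs ->] sN|[g [s [gb hs ->]]] _]].
  have us : u < s.
    rewrite lt_neqAle; case/andP: hs => -> _; rewrite andbT.
    by apply/eqP => us; apply: sN; rewrite us.
  apply: connected_component_sym; apply: seg; first lra.
  by move=> _ [r /= + <-]; rewrite in_itv/= => hr; apply: branch_dpt; lra.
apply: (@connected_component_trans _ _ (dpt g 0)); last by apply: edgeK => //; lra.
apply: (vertexK (tl g)); last by left.
  by rewrite -beyond_tl// beyond_neq.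
by have := len_gt0 g.1; lra.
Qed.

Lemma branch_component h u p : 0 <= u < len h.1 -> branch h u p ->
  connected_component (~` [set dpt h u]) p = branch h u.
Proof.
move=> hu hp; have hu' : 0 <= u <= len h.1 by lra.
have sub : branch h u `<=` ~` [set dpt h u] by move=> q [].
apply/seteqP; split.
  apply: (connected_sub_branch hu' _ _ _ hp); first exact: component_connected.
    by move=> /connected_component_sub; apply.
  exact: (connected_component_refl (sub _ hp)).
by apply: connected_component_max => //; apply: branch_connected.
Qed.

(** The point is interior to its edge, so its removal leaves just two components, the branches of
    [h] and of [opp h], and the second one contains [v]. *)
Lemma is_branchP h u v D : 0 < u < len h.1 -> branch (opp h) (len h.1 - u) v ->
  is_branch v (dpt h u) D <-> D = branch h u.
Proof.
move=> hu vo; have hu1 : 0 <= u < len h.1 by lra.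
have hu2 : 0 <= u <= len h.1 by lra.
have hl : branch h u (dpt h (len h.1)) by apply: branch_dpt; lra.
split; last first.
  move=> ->; split; last by move=> /branch_opp_disjoint; apply.
  exists (dpt h (len h.1)); first by case: hl.
  by rewrite (branch_component hu1 hl).
move=> [[p pN ->] vN].
have [hp|ho] := branch_opp_cover tree hu2 pN; first exact: branch_component.
exfalso; apply: vN; rewrite -dpt_opp branch_component//=; lra.
Qed.

Definition resid h u : R := len h.1 - u + mass h.

Lemma resid_opp h u : resid h u + resid (opp h) (len h.1 - u) = total_length G.
Proof. by rewrite -(mass_opp tree h) /resid /=; lra. Qed.

Lemma resid_end h : resid h (len h.1) = \sum_(g in next h) resid g 0.
Proof.
rewrite /resid subrr add0r mass_next//.
by apply: eq_bigr => g _; rewrite subr0.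
Qed.

Lemma resid_gt0 h u : u < len h.1 -> 0 < resid h u.
Proof. by move=> hu; have := mass_ge0 h; rewrite /resid; lra. Qed.

(** The measure is used as an outer measure, which is monotone on arbitrary sets: the connected sets
    in the definition of the centroid come without measurability. Finiteness, for [fine], comes from
    the lengths of the edges. *)
Lemma length_in_le (A B : set (points G)) : A `<=` B -> length_in A <= length_in B.
Proof.
move=> AB; apply: ler_sum => e _.
pose E := [set x : R | 0 <= x <= len e /\ B (pt e x)].
have fin (F : set R) : F `<=` `[0, len e] -> (lebesgue_measure F < +oo)%E.
  move=> sF; apply: (@le_lt_trans _ _ (lebesgue_measure (`[0, len e] : set R))).
    exact: le_outer_measure.
  by rewrite lebesgue_measure_itv/=; case: ifP => _; rewrite ltry.
have fin' (F : set R) : F `<=` `[0, len e] -> lebesgue_measure F \is a fin_num.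
  move=> sF; rewrite ge0_fin_numE ?fin//; exact: outer_measure_ge0.
apply: fine_le; try by apply: fin' => x /= []; rewrite in_itv.
by apply: le_outer_measure => x /= [? /AB].
Qed.

Lemma length_in_branch h u : 0 <= u < len h.1 -> length_in (branch h u) = resid h u.
Proof.
move=> hu; have hu' : 0 <= u <= len h.1 by lra.
rewrite /length_in (bigD1 h.1)//=; congr (_ + _).
  have -> : [set x : R | 0 <= x <= len h.1 /\ branch h u (pt h.1 x)] =
     if h.2 then `]u, len h.1]%classic else `[0, len h.1 - u[%classic.
    have key s := @branch_dartP _ _ tree h u s hu'.
    case: h hu hu' key => e [] /= hu hu' key; apply/seteqP; split=> x /=; rewrite in_itv/=.
    - by move=> [hx /(key x hx)]; lra.
    - by move=> hx; split; [lra|apply/(key x); lra].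
    - move=> [hx]; have := key (len e - x).
      rewrite /dpt /dart_coord /= subKr => k /k; lra.
    - move=> hx; have := key (len e - x); rewrite /dpt /dart_coord /= subKr => k.
      by split; [lra|apply/k; lra].
  case: ifP => _; rewrite lebesgue_measure_itv /= lte_fin; case: ifP => /=; lra.
rewrite /mass (bigID (fun e => e \in beyond h))/= [X in _ + X]big1 ?addr0.
  rewrite (eq_bigl (fun e => e \in beyond h)); last first.
    by move=> e; rewrite beyondE; case: (e == h.1).
  apply: eq_bigr => e eb.
  have -> : [set x : R | 0 <= x <= len e /\ branch h u (pt e x)] = `[0, len e]%classic.
    apply/seteqP; split=> x /=; rewrite in_itv/=; first by case.
    by move=> hx; split=> //; apply: (@branch_beyond _ _ tree h u (e, true)).
  by rewrite lebesgue_measure_itv/= lte_fin len_gt0/= subr0.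
move=> e /andP[eh eb].
have -> : [set x : R | 0 <= x <= len e /\ branch h u (pt e x)] = set0.
  rewrite -subset0 => x /= [hx]; rewrite branchE//; apply; right; exists (e, true), x.
  by rewrite beyond_opp.
by rewrite measure0.
Qed.

End branch_topology.

(** * Fronts *)

Section fronts.
Context {R : realType} {G : metric_graph R}.
Implicit Types (g h : dart G) (D : {set dart G}) (pos : dart G -> R) (u s t : R).

(** Measuring positions from the tail of a dart absorbs the sign of the normal vector: moving along
    it always adds to the position. *)
Definition normal_at h u : normal_vector G := NormalVector h.1 h.2 (dart_coord h u).

Lemma normal_atP (w : normal_vector G) :
  exists u, w = normal_at (nedge w, nplus w) u.
Proof.
exists (dart_coord (nedge w, nplus w) (npos w)); case: w => e [] x //=.
by rewrite /normal_at /dart_coord/= subKr.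
Qed.

Lemma normal_at_inj g h s t : normal_at g s = normal_at h t -> g = h /\ s = t.
Proof.
case: g h => e b [e' b'] [-> -> ]; rewrite /dart_coord /=.
by case: b' => st; split=> //; lra.
Qed.

Lemma coord_normal_at h u (d : R) : Defs.coord (normal_at h u) d = dart_coord h (u + d).
Proof. by rewrite /Defs.coord /nsign /= /dart_coord; case: h.2; lra. Qed.

Lemma move_along_normal_at h u (d : R) : move_along (normal_at h u) d = dpt h (u + d).
Proof. by rewrite /move_along coord_normal_at. Qed.

Lemma anchored_normal_at h u : anchored (normal_at h u) <-> 0 <= u < len h.1.
Proof.
rewrite /anchored /= /dart_coord; case: h => e [] //=.
by split; lra.
Qed.

(* A front is a set of arms, given by darts and the positions reached on them;
   the branches ahead of the arms are the part of S still to be flooded. *)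
Definition front D pos : Prop :=
  (forall h, h \in D -> 0 <= pos h <= len h.1) /\
  (forall g h p, g \in D -> h \in D ->
     branch g (pos g) p -> branch h (pos h) p -> g = h).

Definition ahead D pos : set (points G) :=
  [set p | exists2 h, h \in D & branch h (pos h) p].

(** An arm standing at the end of its edge anchors no normal vector. *)
Definition active D pos : Prop := forall h, h \in D -> pos h < len h.1.

Definition ended D pos : {set dart G} := [set h in D | pos h == len h.1]%SET.

(** An arm that has reached a vertex splits into the other darts leaving it; at a leaf it
    disappears. *)
Definition renew_darts D pos : {set dart G} :=
  ((D :\: ended D pos) :|: \bigcup_(h in ended D pos) next h)%SET.

Definition renew_pos D pos h : R := if h \in D :\: ended D pos then pos h else 0.

Hypothesis tree : is_tree G.

Section renew.
Context D pos (fr : front D pos).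

Let posP h : h \in D -> 0 <= pos h <= len h.1. Proof. by move/fr.1. Qed.

Lemma endedP h : h \in ended D pos -> h \in D /\ pos h = len h.1.
Proof. by rewrite finset.inE => /andP[-> /eqP]. Qed.

Lemma not_endedP h : h \in D :\: ended D pos -> h \in D /\ pos h < len h.1.
Proof.
rewrite !finset.inE => /andP[/nandP[/negPf->|hN]]// hD.
by rewrite hD lt_neqAle hN; have /andP[_ ->] := posP hD.
Qed.

(** Otherwise the far end of [g] would be ahead of two different arms. *)
Lemma next_ended g h : h \in ended D pos -> g \in next h -> g \notin D :\: ended D pos.
Proof.
move=> /endedP[hD hl] gh; apply/negP => /not_endedP[gD gl].
have := next_neq gh; apply/negP/negPn/eqP; congr (_ .1).
apply: (fr.2 _ _ (dpt g (len g.1))) => //.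
  by apply: branch_dpt => //; have := posP gD; lra.
rewrite hl; apply/(branch_end tree); exists g => //.
by apply: branch_dpt => //; apply: len_gt0.
Qed.

Lemma next_ended_uniq g h k : h \in ended D pos -> k \in ended D pos ->
  g \in next h -> g \in next k -> h = k.
Proof.
move=> /endedP[hD hl] /endedP[kD kl] gh gk.
have gl : branch g 0 (dpt g (len g.1)) by apply: branch_dpt => //; apply: len_gt0.
apply: (fr.2 _ _ (dpt g (len g.1))) => //; rewrite ?hl ?kl;
  by apply/(branch_end tree); exists g.
Qed.

(** The hypothesis is a balance law at the head of each dart. It holds for the length ahead, for the
    cost and for the number of edges left. *)
Lemma renew_sum (F : dart G -> R -> R) :
  (forall h, F h (len h.1) = \sum_(g in next h) F g 0) ->
  \sum_(g in renew_darts D pos) F g (renew_pos D pos g) = \sum_(h in D) F h (pos h).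
Proof.
move=> Fnext.
rewrite [RHS](big_setID (ended D pos))/= addrC.
have -> : D :&: ended D pos = ended D pos.
  by apply/finset.setIidPr/fintype.subsetP => h /endedP[].
rewrite [X in _ = _ + X](eq_bigr (fun h => \sum_(g in next h) F g 0)); last first.
  by move=> h /endedP[_ ->].
pose N := (\bigcup_(h in ended D pos) next h)%SET.
pose O := (D :\: ended D pos)%SET.
have dis g : g \in N -> g \notin O by move=> /bigcupP[h hE gh]; apply: next_ended hE gh.
rewrite /renew_darts -/N -/O (big_setID O)/=.
have -> : ((O :|: N) :&: O)%SET = O by apply/finset.setIidPr/finset.subsetUl.
have -> : ((O :|: N) :\: O)%SET = N.
  apply/setP => g; rewrite finset.in_setD finset.in_setU.
  by have := dis g; case: (g \in O); case: (g \in N) => // /(_ isT).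
congr (_ + _).
  by apply: eq_bigr => g gD; rewrite /renew_pos gD.
transitivity (\sum_(g in N) \sum_(h in ended D pos | g \in next h) F g 0).
  apply: eq_bigr => g /bigcupP[h hE gh]; rewrite /renew_pos (negbTE (next_ended hE gh)).
  rewrite (big_pred1 h)// => k /=; apply/andP/eqP => [[kE gk]|->//].
  exact: next_ended_uniq kE hE gk gh.
rewrite (exchange_big_dep (fun h => h \in ended D pos))/=; last by move=> ? ? _ /andP[].
apply: eq_bigr => h hE; apply: eq_bigl => g; rewrite hE/=.
by apply: andb_idl => gh; apply/bigcupP; exists h.
Qed.

Lemma renewP g : g \in renew_darts D pos ->
  (g \in D :\: ended D pos /\ renew_pos D pos g = pos g) \/
  (exists h, [/\ h \in ended D pos, g \in next h & renew_pos D pos g = 0]).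
Proof.
rewrite finset.in_setU => /orP[gD|/bigcupP[h hE gh]].
  by left; rewrite /renew_pos gD.
by right; exists h; rewrite /renew_pos (negbTE (next_ended hE gh)).
Qed.

Lemma renew_active : active (renew_darts D pos) (renew_pos D pos).
Proof.
move=> g /renewP[[/not_endedP[_ gl] ->]//|[h [_ _ ->]]].
exact: len_gt0.
Qed.

Lemma renew_branch g p : g \in renew_darts D pos ->
  branch g (renew_pos D pos g) p ->
  exists h, [/\ h \in D, branch h (pos h) p &
    (g = h /\ h \in D :\: ended D pos) \/ (g \in next h /\ h \in ended D pos)].
Proof.
move=> /renewP[[gE ->]|[h [hE gh ->]]] gp.
  by have [gD _] := not_endedP gE; exists g; split=> //; left.
have [hD hl] := endedP hE; exists h; split=> //; last by right.
by rewrite hl; apply/(branch_end tree); exists g.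
Qed.

Lemma renew_front : front (renew_darts D pos) (renew_pos D pos).
Proof.
split=> [g|g k p gN kN gp kp].
  move=> /renewP[[/not_endedP[/posP ? _] ->]//|[h [_ _ ->]]].
  by rewrite lexx ltW// len_gt0.
have [h [hD hp gh]] := renew_branch gN gp; have [j [jD jp kj]] := renew_branch kN kp.
have hj := fr.2 _ _ _ hD jD hp jp; subst j.
case: gh kj => [[-> hN]|[gh hE]] [[-> hN']|[kh hE']]//.
- by move: hN; rewrite finset.in_setD hE'.
- by move: hN'; rewrite finset.in_setD hE.
apply/eqP/negPn/negP => gk; move: gp kp.
rewrite /renew_pos (negbTE (next_ended hE gh)) (negbTE (next_ended hE kh)).
by apply: fork_branch_disjoint => //; rewrite (next_tl gh) (next_tl kh).
Qed.

Lemma renew_ahead : ahead (renew_darts D pos) (renew_pos D pos) = ahead D pos.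
Proof.
apply/seteqP; split=> p [h hD hp].
  by have [k [kD kp _]] := renew_branch hD hp; exists k.
case hE : (h \in ended D pos).
  move: hp; rewrite (endedP hE).2 => /(branch_end tree)[g gh gp].
  exists g; last by rewrite /renew_pos (negbTE (next_ended hE gh)).
  by rewrite finset.in_setU; apply/orP; right; apply/bigcupP; exists h.
have hDE : h \in D :\: ended D pos by rewrite finset.in_setD hE.
by exists h; [rewrite finset.in_setU hDE|rewrite /renew_pos hDE].
Qed.

Lemma renew_start g : g \in renew_darts D pos ->
  exists2 h, h \in D & dpt g (renew_pos D pos g) = dpt h (pos h).
Proof.
move=> /renewP[[/not_endedP[gD _] ->]|[h [/endedP[hD hl] gh ->]]]; first by exists g.
by exists h => //; rewrite hl; apply/dpt_next/next_tl.
Qed.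

End renew.

Lemma ahead_closedC D pos : front D pos -> closed (~` ahead D pos).
Proof.
move=> fr; apply: open_closedC.
rewrite (_ : ahead D pos = \bigcup_(h in [set h | h \in D]) branch h (pos h)).
  by apply: bigcup_open => h /= hD; apply: branch_open => //; apply: fr.1.
by apply/seteqP; split=> p [h hD hp]; exists h.
Qed.

Lemma nbhs_dpt_right (A : set (points G)) h u : nbhs (dpt h u) A ->
  exists2 d : R, 0 < d & forall t, 0 < t < d -> A (dpt h (u + t)).
Proof.
move=> /(dpt_continuous (h := h)) [d d0 dA].
exists d => // t ht; apply: dA.
by rewrite /ball /= opprD addrA subrr sub0r normrN gtr0_norm; lra.
Qed.

Lemma lt_both (a b : R) : 0 < a -> 0 < b -> exists2 t, 0 < t < a & t < b.
Proof.
by move=> a0 b0; have [ab|ba] := ltP a b; [exists (a / 2)|exists (b / 2)]; lra.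
Qed.

(** Branches are open: if another one contained the position of the arm, it would also contain
    points slightly further on, which are ahead of [h]. *)
Lemma start_flooded D pos h : front D pos -> h \in D -> pos h < len h.1 ->
  ~ ahead D pos (dpt h (pos h)).
Proof.
move=> fr hD hl [g gD gp].
have hpos := fr.1 _ hD.
have [gh|/eqP gh] := eqVneq g h; first by move: gp; rewrite gh; apply: branch_self.
have : nbhs (dpt h (pos h)) (branch g (pos g)).
  by apply: open_nbhs_nbhs; split=> //; apply: branch_open => //; apply: fr.1.
move=> /nbhs_dpt_right[d d0 dA].
have [|t td tl] := @lt_both d (len h.1 - pos h) d0; first lra.
apply: gh; apply: (fr.2 _ _ (dpt h (pos h + t))) => //; first exact: dA.
by apply: branch_dpt; lra.
Qed.

(** Points just past the anchor of an outward normal vector lie in some branch ahead. Unless that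
    branch belongs to an arm on the same edge in the same direction, it contains the anchor too; but
    the anchor is flooded, since the flooded set is closed. *)
Lemma outward_normalsP D pos w : front D pos -> active D pos ->
  outward_normals (~` ahead D pos) w <->
  exists2 h, h \in D & w = normal_at h (pos h).
Proof.
move=> fr act; have clA := ahead_closedC fr.
split; last first.
  move=> [h hD ->]; have hpos := fr.1 _ hD; have hl := act _ hD.
  split; first by apply/anchored_normal_at; lra.
    split; first by apply: subset_closure; apply: start_flooded.
    move=> /nbhs_dpt_right[d d0 dA].
    have [|t td tl] := @lt_both d (len h.1 - pos h) d0; first lra.
    by apply: (dA t td); exists h => //; apply: branch_dpt; lra.
  exists (len h.1 - pos h) => [|t ht]; first lra.
  by rewrite move_along_normal_at; apply; exists h => //; apply: branch_dpt; lra.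
have [u ->] := normal_atP w; set h := (nedge w, nplus w).
move=> [/anchored_normal_at hu [clu _] [t1 t10 ht1]].
have uA : ~ ahead D pos (dpt h u) by move: clu; rewrite -(closure_id _).1.
have claim t : 0 < t < t1 -> t < len h.1 - u -> h \in D /\ pos h < u + t.
  move=> tt1 tl; have /contrapT := ht1 t tt1.
  rewrite move_along_normal_at => -[g gD gp].
  have gpos := fr.1 _ gD; have gl := act _ gD.
  have [gh|gh] := eqVneq g.1 h.1; last first.
    exfalso; apply: uA; exists g => //.
    have hg : h.1 != g.1 by rewrite eq_sym.
    have gpos' : 0 <= pos g < len g.1 by lra.
    have [hu1 ht] : 0 <= u <= len h.1 /\ 0 <= u + t <= len h.1 by split; lra.
    apply/(branch_otherP tree gpos' hu1 hg).
    exact/(branch_otherP tree gpos' ht hg).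
  have [gE|gE] := dart_eqP gh; move: gp; rewrite gE in gD gpos gl *.
    by rewrite branch_dartP//; lra.
  rewrite branch_oppP// => [gp|]; last lra.
  exfalso; apply: uA; exists (opp h) => //.
  by rewrite branch_oppP//; lra.
have [|t2 t2t t2l] := @lt_both t1 (len h.1 - u) t10; first lra.
have [hD pu] := claim t2 t2t t2l; exists h => //.
have hpos := fr.1 _ hD; have hl := act _ hD.
(* If the arm stood past [u], the claim at half the distance would be contradicted; if it stood
   before [u], the anchor would be ahead of it. *)
have [up|pu'|->//] := ltgtP u (pos h).
  exfalso; suff [_ ?] : h \in D /\ pos h < u + (pos h - u) / 2 by lra.
  by apply: claim; lra.
by exfalso; apply: uA; exists h => //; apply: branch_dpt; lra.
Qed.

(** The arms and their positions are read off as outward normal vectors. Fronts found independently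
    for the same flooded set can thus be identified. *)
Lemma ahead_inj D pos D' pos' : front D pos -> active D pos ->
  front D' pos' -> active D' pos' -> ahead D pos = ahead D' pos' ->
  D = D' /\ forall h, h \in D -> pos h = pos' h.
Proof.
move=> fr act fr' act' E.
have key D1 pos1 D2 pos2 : front D1 pos1 -> active D1 pos1 ->
  front D2 pos2 -> active D2 pos2 -> ahead D1 pos1 = ahead D2 pos2 ->
  forall h, h \in D1 -> h \in D2 /\ pos1 h = pos2 h.
  move=> fr1 act1 fr2 act2 E12 h hD.
  have := (outward_normalsP (normal_at h (pos1 h)) fr1 act1).2.
  rewrite E12 => /(_ (ex_intro2 _ _ h hD erefl)) /(outward_normalsP _ fr2 act2).
  by move=> [g gD /normal_at_inj[-> ->]].
split; last by move=> h /(key _ _ _ _ fr act fr' act' E)[].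
apply/setP => h; apply/idP/idP.
  by move=> /(key _ _ _ _ fr act fr' act' E)[].
by move=> /(key _ _ _ _ fr' act' fr act (esym E))[].
Qed.

Section advance.
Context D pos (pos1 : dart G -> R) (fr : front D pos).
Hypothesis pos_le : forall h, h \in D -> pos h <= pos1 h <= len h.1.

Let le0 h : h \in D -> 0 <= pos h <= pos1 h /\ pos1 h <= len h.1.
Proof. by move=> hD; have := fr.1 _ hD; have := pos_le hD; split; lra. Qed.

Lemma advance_front : front D pos1.
Proof.
split=> [h hD|g h p gD hD gp hp]; first by have := le0 hD; lra.
have [? ?] := le0 gD; have [? ?] := le0 hD.
by apply: (fr.2 _ _ p) => //; [apply: branch_sub gp|apply: branch_sub hp].
Qed.

Lemma advance_ahead p : ahead D pos p <->
  ahead D pos1 p \/ exists h s, [/\ h \in D, pos h < s <= pos1 h & p = dpt h s].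
Proof.
split.
  move=> [h hD]; have [? ?] := le0 hD.
  rewrite (@branch_split _ _ tree h (pos h) (pos1 h))//.
  by move=> [hp|[s hs ->]]; [left; exists h|right; exists h, s].
move=> [[h hD hp]|[h [s [hD hs ->]]]]; have [? ?] := le0 hD; exists h => //.
  exact: branch_sub hp.
by apply: branch_dpt; lra.
Qed.

Lemma advance_flooded : ~` ahead D pos1 =
  ~` ahead D pos `|` [set p | exists h s, [/\ h \in D, pos h < s <= pos1 h & p = dpt h s]].
Proof.
apply/seteqP; split=> p.
  move=> pN; have [pa|] := EM (ahead D pos p); last by left.
  by right; move/advance_ahead: pa => [].
case=> [pN pa|[h [s [hD hs ->]]] [g gD gp]].
  by apply: pN; apply/advance_ahead; left.
have [? ?] := le0 hD; have [? ?] := le0 gD.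
have gh : g = h.
  apply: (fr.2 _ _ (dpt h s)) => //; first exact: branch_sub gp.
  by apply: branch_dpt; lra.
by move: gp; rewrite gh branch_dartP//; lra.
Qed.

End advance.

(* The integral of ln (resid h s) over the branch plus the length of the branch,
   xlnx x - x being a primitive of ln. *)
Definition cost h u : R := xlnx (resid h u) - xlnx (mass h) + tail_cost h.

Lemma cost_end h : cost h (len h.1) = \sum_(g in next h) cost g 0.
Proof.
rewrite /cost {1}/resid subrr !add0r subrr add0r tail_cost_next//.
by apply: eq_bigr => g _; rewrite /resid subr0.
Qed.

Definition unflooded D pos : R := \sum_(h in D) resid h (pos h).

(* The largest entropy of a flooding of the branches ahead of a front. *)
Definition potential D pos : R :=
  xlnx (unflooded D pos) - \sum_(h in D) cost h (pos h).

Lemma renew_unflooded D pos : front D pos ->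
  unflooded (renew_darts D pos) (renew_pos D pos) = unflooded D pos.
Proof. by move=> fr; apply: renew_sum => // h; apply: resid_end. Qed.

Lemma renew_potential D pos : front D pos ->
  potential (renew_darts D pos) (renew_pos D pos) = potential D pos.
Proof.
move=> fr; rewrite /potential renew_unflooded//; congr (_ - _).
by apply: renew_sum => // h; apply: cost_end.
Qed.

Lemma unflooded_advance D pos (z : dart G -> R) (tau : R) :
  \sum_(h in D) z h = 1 ->
  unflooded D (fun h => pos h + z h * tau) = unflooded D pos - tau.
Proof.
move=> z1; rewrite /unflooded -[X in _ - X]mul1r -z1 mulr_suml -sumrB.
by apply: eq_bigr => h _; rewrite /resid; lra.
Qed.

(** Superadditivity, with [d] the lengths flooded during the phase and [r] those left. For a fixed
    dart, [cost h] differs from [xlnx (resid h _)] by a constant, which cancels between the two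
    potentials. *)
Lemma phase_entropy D pos (z : dart G -> R) (tau : R) : front D pos -> active D pos ->
  0 < tau -> (forall h, h \in D -> 0 <= z h) -> \sum_(h in D) z h = 1 ->
  (forall h, h \in D -> pos h + z h * tau <= len h.1) ->
  let gap := potential D pos - potential D (fun h => pos h + z h * tau)
    + tau * \sum_(h in D) z h * ln (z h) in
  0 <= gap /\ (gap = 0 <-> forall h, h \in D -> z h = resid h (pos h) / unflooded D pos).
Proof.
move=> fr act t0 z0 z1 zl gap.
pose d h := z h * tau; pose r h := resid h (pos h + z h * tau).
have dr h : d h + r h = resid h (pos h) by rewrite /d /r /resid; lra.
have d0 h : h \in D -> 0 <= d h by move=> hD; rewrite mulr_ge0 ?z0// ltW.
have r0 h : h \in D -> 0 <= r h.
  by move=> hD; have := zl _ hD; have := mass_ge0 h; rewrite /r /resid; lra.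
have x0 h : h \in D -> 0 < d h + r h by move=> hD; rewrite dr resid_gt0// act.
have sd : \sum_(h in D) d h = tau by rewrite -mulr_suml z1 mul1r.
have := entropy_superadditive t0 d0 r0 x0 sd.
have -> : \sum_(h in D) (d h + r h) = unflooded D pos.
  by apply: eq_bigr => h _; rewrite dr.
rewrite /=; set gap' := (X in 0 <= X).
have E : gap' = gap.
  rewrite /gap' /gap /potential unflooded_advance// /cost.
  have -> : xlnx tau - \sum_(h in D) xlnx (d h) = - (tau * \sum_(h in D) z h * ln (z h)).
    rewrite {1}/xlnx -{1}sd mulr_suml -sumrB mulr_sumr -sumrN; apply: eq_bigr => h hD.
    (* An arm at rest is treated apart, since [lnM] asks for positive factors; both sides are then
       0. *)
    have := z0 _ hD; rewrite /d /xlnx le_eqVlt => /predU1P[<-|zh]; first lra.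
    by rewrite lnM ?posrE//; lra.
  rewrite (eq_bigr (fun h => xlnx (resid h (pos h)))); last by move=> h _; rewrite dr.
  rewrite !big_split/= !sumrN -/(r _); lra.
rewrite -E => -[g0 gE]; split=> //; apply: (iff_trans gE).
split=> h1 h hD; have := h1 h hD; rewrite dr.
  rewrite /d mulrC => /(mulfI _); apply; lra.
by move=> zE; rewrite /d {1}zE; lra.
Qed.

End fronts.

(** * The entropy bound *)

Section floodings.
Context {R : realType} {G : metric_graph R}.
Implicit Types (g h : dart G) (D : {set dart G}) (pos z : dart G -> R) (u s t : R).
Hypothesis tree : is_tree G.

Lemma front_sweep D pos z t : front D pos -> active D pos -> 0 <= t ->
  (forall h, h \in D -> 0 <= z h) -> (forall h, h \in D -> pos h + z h * t <= len h.1) ->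
  ~` ahead D pos `|`
    [set p | exists h s, [/\ h \in D, 0 <= s <= t & p = dpt h (pos h + z h * s)]] =
  ~` ahead D (fun h => pos h + z h * t).
Proof.
move=> fr act t0 z0 zl.
have zt0 h : h \in D -> 0 <= z h * t by move=> hD; rewrite mulr_ge0 ?z0.
rewrite (@advance_flooded _ _ tree _ _ (fun h => pos h + z h * t) fr); last first.
  by move=> h hD; have := zt0 _ hD; have := zl _ hD; lra.
apply/seteqP; split=> p [pN|[h [s [hD hs ->]]]]; try by left.
  have zs : z h * s <= z h * t by apply: ler_wpM2l; [exact: z0|lra].
  have : 0 <= z h * s by apply: mulr_ge0; [exact: z0|lra].
  (* The initial position of an arm, swept at [s = 0] or by an arm at rest, is already flooded. *)
  rewrite le_eqVlt => /predU1P[<-|zs0].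
    by left; rewrite addr0; apply: start_flooded => //; apply: act.
  by right; exists h, (pos h + z h * s); split=> //; lra.
have zh : 0 < z h.
  by rewrite lt0r z0// andbT; apply/eqP => zh; move: hs; rewrite zh; lra.
right; exists h, ((s - pos h) / z h); split=> //.
  by apply/andP; split; [apply: divr_ge0|rewrite ler_pdivrMr// mulrC]; lra.
by rewrite mulrCA divff ?gt_eqF// mulr1; congr dpt; lra.
Qed.

Lemma active_empty D pos : front D pos -> active D pos -> ahead D pos = set0 -> D = finset.set0.
Proof.
move=> fr act a0; apply/setP => h; rewrite finset.in_set0; apply/negP => hD.
have : ahead D pos (dpt h (len h.1)).
  exists h => //; apply: branch_dpt => //; last exact: act.
  by case/andP: (fr.1 _ hD).
by rewrite a0.
Qed.

(** A single point seen as a front: two opposite arms on an edge containing it. If the point is a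
    vertex, renewal replaces the arm that stands at the end of the edge by the other darts leaving
    it. *)
Definition start_darts h : {set dart G} := [set h; opp h]%SET.

Definition start_pos h u g : R := if g == h then u else len h.1 - u.

Section start.
Context h u (hu : 0 <= u <= len h.1).

Lemma start_sum (F : dart G -> R -> R) :
  \sum_(g in start_darts h) F g (start_pos h u g) = F h u + F (opp h) (len h.1 - u).
Proof.
rewrite big_setU1/=; last by rewrite finset.in_set1 eq_sym opp_neq.
by rewrite big_set1 /start_pos eqxx (negbTE (opp_neq h)).
Qed.

Lemma start_front : front (start_darts h) (start_pos h u).
Proof.
split=> [g|g k p].
  rewrite !finset.inE => /orP[/eqP->|/eqP->]; first by rewrite /start_pos eqxx.
  by rewrite /start_pos (negbTE (opp_neq h)) /=; have := hu; lra.
rewrite !finset.inE => /orP[/eqP->|/eqP->] /orP[/eqP->|/eqP->] //;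
  rewrite /start_pos eqxx (negbTE (opp_neq h)) => h1 h2.
  by case: (branch_opp_disjoint tree hu h1 h2).
by case: (branch_opp_disjoint tree hu h2 h1).
Qed.

Lemma start_ahead : ahead (start_darts h) (start_pos h u) = ~` [set dpt h u].
Proof.
apply/seteqP; split=> p.
  move=> [g]; rewrite !finset.inE => /orP[/eqP->|/eqP->].
    by rewrite /start_pos eqxx => -[].
  by rewrite /start_pos (negbTE (opp_neq h)) => -[_]; rewrite dpt_opp.
move=> /(branch_opp_cover tree hu)[ph|po].
  by exists h; rewrite ?finset.inE ?eqxx// /start_pos eqxx.
by exists (opp h); rewrite ?finset.inE ?eqxx ?orbT// /start_pos (negbTE (opp_neq h)).
Qed.

Lemma start_unflooded : unflooded (start_darts h) (start_pos h u) = total_length G.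
Proof. by rewrite /unflooded start_sum resid_opp. Qed.

Definition start_bound : R :=
  xlnx (total_length G) - (cost h u + cost (opp h) (len h.1 - u)).

Lemma start_potential : potential (start_darts h) (start_pos h u) = start_bound.
Proof. by rewrite /potential start_unflooded start_sum. Qed.

End start.

Section phases.
Context (f : flooding G).

Definition flood_front k D pos : Prop := [/\ front D pos, active D pos,
  f (times f k) = ~` ahead D pos & unflooded D pos = total_length G - times f k].

Definition arm_dart k (j : 'I_(narms f k)) : dart G :=
  (nedge (arm f k j), nplus (arm f k j)).

(** On the darts of the front the sum has a single term, [arm_dart] being injective there; this form
    avoids choosing an inverse of [arm_dart]. *)
Definition dart_speed k h : R := \sum_(j | arm_dart j == h) speed f k j.

Context k (kn : (k < nphases f)%N) D pos (kD : flood_front k D pos).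

Let tau : R := times f k.+1 - times f k.

Let tau_gt0 : 0 < tau. Proof. by rewrite subr_gt0 times_lt. Qed.

Lemma arm_dartE j : arm_dart j \in D /\ arm f k j = normal_at (arm_dart j) (pos (arm_dart j)).
Proof.
have [fr act fE _] := kD.
have : range (arm f k) (arm f k j) by exists j.
rewrite arm_range// fE => /(outward_normalsP tree _ fr act)[h hD hE].
have -> : arm_dart j = h by rewrite /arm_dart hE; case: h {hD hE}.
by [].
Qed.

Lemma arm_dart_inj : injective (@arm_dart k).
Proof.
move=> i j ij; apply: (arm_inj kn).
by rewrite (arm_dartE i).2 (arm_dartE j).2 ij.
Qed.

Lemma arm_dart_onto : D = [set arm_dart j | j : 'I_(narms f k)]%SET.
Proof.
have [fr act fE _] := kD.
apply/setP => h; apply/idP/imsetP => [hD|[j _ ->]]; last exact: (arm_dartE j).1.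
have : outward_normals (f (times f k)) (normal_at h (pos h)).
  by rewrite fE; apply/outward_normalsP => //; exists h.
rewrite -arm_range// => -[j _ jE]; exists j => //.
by rewrite /arm_dart jE; case: h {hD jE}.
Qed.

Lemma dart_speedE j : dart_speed k (arm_dart j) = speed f k j.
Proof.
rewrite /dart_speed (big_pred1 j)// => i /=.
by rewrite (inj_eq arm_dart_inj).
Qed.

Lemma sum_arms (F : dart G -> R -> R) :
  \sum_(h in D) F h (dart_speed k h) = \sum_(j < narms f k) F (arm_dart j) (speed f k j).
Proof.
rewrite arm_dart_onto big_imset/=; last by move=> i j _ _; apply: arm_dart_inj.
by apply: eq_big => [j|j _]; rewrite ?finset.inE// dart_speedE.
Qed.

Lemma dart_speed_ge0 h : h \in D -> 0 <= dart_speed k h.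
Proof. by move=> _; apply: sumr_ge0 => j _; apply: speed_ge0. Qed.

Lemma dart_speed_sum : \sum_(h in D) dart_speed k h = 1.
Proof. by rewrite (sum_arms (fun _ s => s)) speed_sum. Qed.

(** An arm that overshot its edge would already be outside it slightly before the end of the phase,
    against the infimum that defines this end. *)
Lemma phase_bound h : h \in D -> pos h + dart_speed k h * tau <= len h.1.
Proof.
move=> hD; have [fr act _ _] := kD.
rewrite leNgt; apply/negP => hl; have := act _ hD => hp.
have z0 := dart_speed_ge0 hD.
have z_gt0 : 0 < dart_speed k h.
  by rewrite lt0r z0 andbT; apply/eqP => zh; move: hl; rewrite zh; lra.
(* [d] is shorter than the phase and so small that the arm is still outside its edge at time
   [times f k.+1 - d]. *)
have [|d hd dz] := @lt_both _ tau
    ((pos h + dart_speed k h * tau - len h.1) / dart_speed k h) tau_gt0.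
  by apply: divr_gt0 => //; lra.
move: dz; rewrite ltr_pdivlMr// => dz.
have : times f k.+1 <= times f k.+1 - d; last by rewrite /tau in hd; lra.
rewrite -lee_fin times_inf//; apply: ereal_inf_lbound; exists (times f k.+1 - d) => //.
split; first by rewrite /tau in hd; lra.
left; move: hD; rewrite arm_dart_onto => /imsetP[j _ hj]; exists j.
have jE := (arm_dartE j).2.
rewrite jE coord_normal_at -hj /=; rewrite dart_coord_bound => /andP[_].
rewrite -dart_speedE -hj; apply/negP; rewrite -ltNge.
have -> : times f k.+1 - d - times f k = tau - d by rewrite /tau; lra.
by rewrite mulrBr; lra.
Qed.

Lemma phase_flood t : times f k <= t <= times f k.+1 ->
  f t = ~` ahead D (fun h => pos h + dart_speed k h * (t - times f k)).
Proof.
move=> ht; have [fr act fE _] := kD.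
rewrite -front_sweep//; first 1 last.
- by lra.
- exact: dart_speed_ge0.
- move=> h hD; apply: le_trans (phase_bound hD); rewrite lerD2l.
  by apply: ler_wpM2l; [exact: dart_speed_ge0|rewrite /tau; lra].
rewrite (flood_phase kn ht) fE; congr (_ `|` _); apply/seteqP; split=> p.
  move=> [j [s [hs ->]]]; exists (arm_dart j), (s - times f k).
  have [jD jE] := arm_dartE j; split=> //; first lra.
  by rewrite {1}jE move_along_normal_at dart_speedE.
move=> [h [s [hD hs ->]]].
move: hD; rewrite arm_dart_onto => /imsetP[j _ ->]; exists j, (s + times f k).
split; first lra.
by rewrite (arm_dartE j).2 move_along_normal_at dart_speedE addrK.
Qed.

Let pos1 h : R := pos h + dart_speed k h * tau.

Lemma advance_phase_front : front D pos1.
Proof.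
have [fr _ _ _] := kD; apply: (advance_front tree fr) => h hD.
rewrite phase_bound// andbT lerDl; apply: mulr_ge0; last exact/ltW.
exact: dart_speed_ge0.
Qed.

Lemma next_flood_front : flood_front k.+1 (renew_darts D pos1) (renew_pos D pos1).
Proof.
have [fr act fE uE] := kD; have fr1 := advance_phase_front; split.
- exact: renew_front.
- exact: renew_active.
- rewrite renew_ahead// phase_flood// ltW ?times_lt//=.
- rewrite renew_unflooded// unflooded_advance; last exact: dart_speed_sum.
  by rewrite uE /tau; lra.
Qed.

End phases.

Lemma flood_front_potential (f : flooding G) k D pos D' pos' :
  flood_front f k D pos -> flood_front f k D' pos' -> potential D pos = potential D' pos'.
Proof.
move=> [fr act fE _] [fr' act' fE' _].
have [|DD posE] := ahead_inj tree fr act fr' act'.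
  by rewrite -[LHS]setCK -fE fE' setCK.
rewrite /potential /unflooded -DD; congr (xlnx _ - _); apply: eq_bigr => h hD;
  by rewrite posE.
Qed.

Lemma flood_frontP (f : flooding G) h u : 0 <= u < len h.1 -> f 0 = [set dpt h u] ->
  exists S : nat -> {set dart G} * (dart G -> R),
    (forall k, (k <= nphases f)%N -> flood_front f k (S k).1 (S k).2) /\
    potential (S 0%N).1 (S 0%N).2 = start_bound h u.
Proof.
move=> hu f0; have hu' : 0 <= u <= len h.1 by lra.
have fr0 := start_front hu'.
pose D0 := renew_darts (start_darts h) (start_pos h u).
pose p0 := renew_pos (start_darts h) (start_pos h u).
have good0 : flood_front f 0 D0 p0.
  split; [exact: renew_front|exact: renew_active| |].
    by rewrite renew_ahead// start_ahead// times0 f0 setCK.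
  by rewrite renew_unflooded// start_unflooded// times0 subr0.
have ex k : exists S : {set dart G} * (dart G -> R),
    (k <= nphases f)%N -> flood_front f k S.1 S.2.
  elim: k => [|k [S IH]]; first by exists (D0, p0).
  have [kn|kn] := ltnP k (nphases f); last by exists S.
  by eexists (_, _) => _; apply: next_flood_front => //; apply: IH; apply: ltnW.
(* The choice forgets how the front of one phase arises from the previous one;
   [flood_front_potential] makes up for it. *)
have [S SP] := choice ex; exists S; split=> //.
rewrite (flood_front_potential (SP 0%N (leq0n _)) good0).
by rewrite renew_potential// start_potential.
Qed.

(** The nonnegative gaps of the phases add up to the difference between the bound and the entropy,
    since the potential telescopes down to 0 when nothing is left. If the difference vanishes, so
    does every gap. *)
Lemma entropy_le (f : flooding G) h u : 0 <= u < len h.1 -> f 0 = [set dpt h u] ->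
  entropy f <= start_bound h u /\
  (entropy f = start_bound h u -> forall k, (k < nphases f)%N ->
    exists D pos, flood_front f k D pos /\
      forall g, g \in D -> dart_speed f k g = resid g (pos g) / unflooded D pos).
Proof.
move=> hu f0; have [S [SP S0]] := flood_frontP hu f0.
pose n := nphases f.
pose gap k := potential (S k).1 (S k).2 - potential (S k.+1).1 (S k.+1).2 +
  (times f k.+1 - times f k) * \sum_(j < narms f k) speed f k j * ln (speed f k j).
have gapP k : (k < n)%N -> 0 <= gap k /\ (gap k = 0 -> forall g, g \in (S k).1 ->
    dart_speed f k g = resid g ((S k).2 g) / unflooded (S k).1 (S k).2).
  move=> kn; have gk := SP k (ltnW kn); have [fr act fE _] := gk.
  have := @phase_entropy _ _ (S k).1 (S k).2 (dart_speed f k) (times f k.+1 - times f k) fr act.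
  rewrite subr_gt0 times_lt// => /(_ isT (dart_speed_ge0 kn (D := _)) (dart_speed_sum kn gk)).
  move=> /(_ (fun g => phase_bound kn gk (h := g))) /=.
  rewrite -(renew_potential tree (advance_phase_front kn gk)).
  rewrite (flood_front_potential (next_flood_front kn gk) (SP k.+1 kn)).
  by rewrite (sum_arms kn gk (fun _ s => s * ln s)) => -[? [? _]].
have Sn : potential (S n).1 (S n).2 = 0.
  have [fr act fE _] := SP n (leqnn _).
  rewrite /potential /unflooded (active_empty fr act); last first.
    by rewrite -[LHS]setCK -fE flood_end// setCT.
  by rewrite !big_set0 /xlnx mul0r subrr.
have sum_gap : \sum_(k < n) gap k = start_bound h u - entropy f.
  rewrite /gap big_split/= /entropy opprK; congr (_ + _).
  have := telescope_sumr (fun k => potential (S k).1 (S k).2) (leq0n n).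
  rewrite big_mkord Sn S0 sub0r => /(congr1 -%R); rewrite opprK -sumrN => <-.
  by apply: eq_bigr => k _; rewrite opprB.
split.
  by rewrite -subr_ge0 -sum_gap; apply: sumr_ge0 => k _; apply: (gapP k _).1.
move=> fE k kn; exists (S k).1, (S k).2; split; first exact/SP/ltnW.
apply: (gapP k kn).2; move: sum_gap; rewrite fE subrr => /eqP.
rewrite psumr_eq0; last by move=> i _; apply: (gapP i _).1.
by move=> /allP/(_ (Ordinal kn) (mem_index_enum _))/eqP.
Qed.

End floodings.

(** * Schedules of optimal phases *)

Section schedule.
Context {R : realType} {G : metric_graph R}.
Implicit Types (g h : dart G) (u s t : R).
Hypothesis tree : is_tree G.

Definition state : Type := ({set dart G} * (dart G -> R))%type.
Implicit Types S : state.

Definition ideal_speed S h : R := resid h (S.2 h) / unflooded S.1 S.2.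

Definition moved S t h : R := S.2 h + ideal_speed S h * t.

Definition phase_step S (tau : R) S' : Prop :=
  [/\ forall h, h \in S.1 -> moved S tau h <= len h.1,
      exists2 h, h \in S.1 & moved S tau h = len h.1,
      S'.1 = renew_darts S.1 (moved S tau) & S'.2 = renew_pos S.1 (moved S tau)].

Section ideal_speed.
Context S (act : active S.1 S.2) h0 (h0S : h0 \in S.1).

Lemma unflooded_gt0 : 0 < unflooded S.1 S.2.
Proof.
rewrite /unflooded (bigD1 h0)//=; apply: ltr_pwDl.
  by apply: resid_gt0; apply: act.
by apply: sumr_ge0 => h /andP[hS _]; apply/ltW/resid_gt0/act.
Qed.

Lemma ideal_speed_gt0 h : h \in S.1 -> 0 < ideal_speed S h.
Proof. by move=> hS; rewrite divr_gt0 ?unflooded_gt0// resid_gt0// act. Qed.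

Lemma ideal_speed_sum : \sum_(h in S.1) ideal_speed S h = 1.
Proof. by rewrite -mulr_suml divff// gt_eqF// unflooded_gt0. Qed.

Lemma phase_step_ex : exists tau S', 0 < tau /\ phase_step S tau S'.
Proof.
(* The time after which arm [h] would reach the end of its edge; the phase lasts until the first
   arrival. *)
pose F h := (len h.1 - S.2 h) / ideal_speed S h.
case: (@arg_minP _ _ _ h0 (mem S.1) F h0S) => h hS hmin.
exists (F h), (renew_darts S.1 (moved S (F h)), renew_pos S.1 (moved S (F h))).
have Fh g : g \in S.1 -> ideal_speed S g * F g = len g.1 - S.2 g.
  by move=> gS; rewrite /F mulrCA divff ?mulr1// gt_eqF// ideal_speed_gt0.
split; first by rewrite divr_gt0 ?ideal_speed_gt0// subr_gt0 act.
split=> //.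
  move=> g gS; rewrite /moved.
  have : ideal_speed S g * F h <= ideal_speed S g * F g.
    by apply: ler_wpM2l; [exact/ltW/ideal_speed_gt0|exact: hmin].
  by rewrite Fh//; lra.
by exists h => //; rewrite /moved Fh//; lra.
Qed.

End ideal_speed.

Lemma moved_front S tau : front S.1 S.2 -> active S.1 S.2 -> 0 <= tau ->
  (forall h, h \in S.1 -> moved S tau h <= len h.1) -> front S.1 (moved S tau).
Proof.
move=> fr act t0 le_len; apply: (advance_front tree fr) => h hS.
rewrite le_len// andbT /moved lerDl mulr_ge0//.
exact: ltW (ideal_speed_gt0 act hS hS).
Qed.

Lemma phase_step_front S tau S' : front S.1 S.2 -> active S.1 S.2 -> 0 < tau ->
  phase_step S tau S' ->
  [/\ front S'.1 S'.2, active S'.1 S'.2 & ahead S'.1 S'.2 = ahead S.1 (moved S tau)].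
Proof.
move=> fr act t0 [le_len _ -> ->]; have fr1 := moved_front fr act (ltW t0) le_len.
split; [exact: renew_front|exact: renew_active|exact: renew_ahead].
Qed.

(* Each phase leaves fewer edges, beyond or ahead of the arms, to be reached. *)
Definition edges_left h u : R := \sum_(e in beyond h) 1 + (u < len h.1)%R%:R.

Lemma edges_left_end h : edges_left h (len h.1) = \sum_(g in next h) edges_left g 0.
Proof.
rewrite /edges_left ltxx addr0 sum_beyond//.
by apply: eq_bigr => g _; rewrite len_gt0 addrC.
Qed.

Lemma schedule_ex (m : nat) S : front S.1 S.2 -> active S.1 S.2 ->
  \sum_(h in S.1) edges_left h (S.2 h) <= m%:R ->
  exists (n : nat) (St : nat -> state) (tau : nat -> R),
    [/\ St 0%N = S, (forall k, 0 < tau k),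
        (forall k, (k < n)%N -> phase_step (St k) (tau k) (St k.+1)) &
        (St n).1 = finset.set0].
Proof.
elim: m S => [|m IH] S fr act hm; have [S0|[h0 h0S]] := set_0Vmem S.1;
  try by exists 0%N, (fun=> S), (fun=> 1); split=> // k; apply: ltr01.
  exfalso; move: hm; rewrite leNgt => /negP; apply.
  rewrite (bigD1 h0)//=; apply: ltr_pwDl.
    by rewrite /edges_left act// ltr_wpDl// sumr_ge0.
  by apply: sumr_ge0 => h _; rewrite addr_ge0// sumr_ge0.
have [tau [S' [t0 st]]] := phase_step_ex act h0S.
have [fr' act' _] := phase_step_front fr act t0 st.
have [|n [St [ta [St0 ta0 Stk Stn]]]] := IH S' fr' act'; last first.
  exists n.+1, (fun k => if k is k'.+1 then St k' else S),
    (fun k => if k is k'.+1 then ta k' else tau); split=> //.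
    by case.
  by case=> [|k] kn; [rewrite St0|apply: Stk].
case: st => le_len [h1 h1S h1E] -> ->.
have fr1 := moved_front fr act (ltW t0) le_len.
(* Renewal does not change the count, so it can be compared arm by arm before and after the move:
   [h1] loses its unit and no other arm gains one. *)
rewrite (renew_sum tree fr1 edges_left_end).
rewrite -(lerD2r 1) natr1; apply: le_trans hm.
rewrite (bigD1 h1)//= [leRHS](bigD1 h1)//= -addrA [_ + 1]addrC addrA.
apply: lerD; first by rewrite /edges_left h1E ltxx act// addr0.
apply: ler_sum => h /andP[hS _]; rewrite /edges_left act//.
by rewrite lerD2l ler_nat; case: (_ < _).
Qed.

End schedule.

(** * The optimal flooding *)

Section scheduled_flooding.
Context {R : realType} {G : metric_graph R}.
Implicit Types (g h : dart G) (u s t : R).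
Hypothesis tree : is_tree G.
Context (n : nat) (St : nat -> @state R G) (tau : nat -> R).
Hypothesis St_front : front (St 0).1 (St 0).2.
Hypothesis St_active : active (St 0).1 (St 0).2.
Hypothesis St_connected : connected (~` ahead (St 0).1 (St 0).2).
Hypothesis tau_gt0 : forall k, 0 < tau k.
Hypothesis St_step : forall k, (k < n)%N -> phase_step (St k) (tau k) (St k.+1).
Hypothesis St_end : (St n).1 = finset.set0.

Local Notation D k := (St k).1.
Local Notation P k := (St k).2.

Definition sched_time (k : nat) : R := \sum_(i < k) tau i.

Lemma sched_timeS k : sched_time k.+1 = sched_time k + tau k.
Proof. by rewrite /sched_time big_ord_recr. Qed.

Lemma sched_time0 : sched_time 0 = 0.
Proof. by rewrite /sched_time big_ord0. Qed.

Lemma sched_time_lt k : sched_time k < sched_time k.+1.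
Proof. by rewrite sched_timeS ltrDl. Qed.

Lemma sched_time_le : {homo sched_time : i j / (i <= j)%N >-> i <= j}.
Proof.
by apply: homo_leq => // [x|i]; [exact: le_trans|exact/ltW/sched_time_lt].
Qed.

Lemma sched_front k : (k <= n)%N -> front (D k) (P k) /\ active (D k) (P k).
Proof.
elim: k => [//|k IH kn]; have [fr act] := IH (ltnW kn).
by have [] := phase_step_front tree fr act (tau_gt0 k) (St_step kn).
Qed.

Lemma sched_nonempty k : (k < n)%N -> exists h, h \in D k.
Proof. by move=> kn; have [_ [h hD _] _ _] := St_step kn; exists h. Qed.

Lemma sched_speed_gt0 k h : (k < n)%N -> h \in D k -> 0 < ideal_speed (St k) h.
Proof.
move=> kn hD; have [_ act] := sched_front (ltnW kn).
exact: (ideal_speed_gt0 act hD).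
Qed.

Lemma sched_moved k s h : (k < n)%N -> h \in D k -> s <= tau k ->
  moved (St k) s h <= len h.1.
Proof.
move=> kn hD st; have [le_len _ _ _] := St_step kn.
apply: le_trans (le_len _ hD); rewrite lerD2l ler_wpM2l//.
exact/ltW/(sched_speed_gt0 kn).
Qed.

(** Defined for all times at once as a union, so that monotonicity is immediate. The strict
    [sched_time k < t] keeps phase [k] out of the set at its own starting time, which then consists
    of the completed phases only. *)
Definition sched_flood t : set (points G) :=
  ~` ahead (D 0) (P 0) `|` [set p | exists k h s,
    [/\ (k < n)%N, h \in D k, 0 <= s <= tau k,
        sched_time k < t /\ sched_time k + s <= t & p = dpt h (moved (St k) s h)]].

Definition swept k t : set (points G) :=
  [set p | exists h s, [/\ h \in D k, 0 <= s <= t & p = dpt h (moved (St k) s h)]].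

Lemma sched_flood_split k t : (k < n)%N -> sched_time k < t <= sched_time k.+1 ->
  sched_flood t = sched_flood (sched_time k) `|` swept k (t - sched_time k).
Proof.
move=> kn; rewrite sched_timeS => ht; apply/seteqP; split=> p.
  case=> [p0|[i [h [s [ik hD hs [it st] pE]]]]]; first by left; left.
  have [ik'|ki|ik'] := ltngtP i k; last 2 first.
  - have := sched_time_le ki; rewrite sched_timeS; lra.
  - by subst i; right; exists h, s; split=> //; lra.
  left; right; exists i, h, s; split=> //; split.
    by apply: lt_le_trans (sched_time_lt i) (sched_time_le ik').
  by have := sched_time_le ik'; rewrite sched_timeS; lra.
case=> [[p0|[i [h [s [ik hD hs [it st] pE]]]]]|[h [s [hD hs pE]]]]; first by left.
  by right; exists i, h, s; split=> //; split; lra.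
by right; exists k, h, s; split=> //; lra.
Qed.

Lemma swept_ahead k t : (k < n)%N -> 0 <= t <= tau k ->
  ~` ahead (D k) (P k) `|` swept k t = ~` ahead (D k) (moved (St k) t).
Proof.
move=> kn ht; have [fr act] := sched_front (ltnW kn).
apply: (front_sweep tree fr act); first lra.
  by move=> h hD; exact/ltW/(sched_speed_gt0 kn).
by move=> h hD; apply: sched_moved => //; lra.
Qed.

Lemma moved0 (S : @state R G) h : moved S 0 h = S.2 h.
Proof. by rewrite /moved mulr0 addr0. Qed.

Lemma moved0_fun (S : @state R G) : moved S 0 = S.2.
Proof. by apply/funext => h; apply: moved0. Qed.

Lemma sched_flood_ahead k : (k <= n)%N -> sched_flood (sched_time k) = ~` ahead (D k) (P k).
Proof.
elim: k => [_|k IH kn].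
  rewrite sched_time0; apply/seteqP; split=> p; last by left.
  case=> // -[k [h [s [_ _ _ [+ _] _]]]].
  by rewrite ltNge -sched_time0 sched_time_le.
rewrite (sched_flood_split kn) ?sched_time_lt ?lexx// IH ?(ltnW kn)//.
rewrite sched_timeS addrAC subrr add0r swept_ahead ?lexx ?ltW//.
have [fr act] := sched_front (ltnW kn).
by have [_ _ ->] := phase_step_front tree fr act (tau_gt0 k) (St_step kn).
Qed.

Lemma sched_flood_swept k t : (k < n)%N -> sched_time k <= t <= sched_time k.+1 ->
  sched_flood t = sched_flood (sched_time k) `|` swept k (t - sched_time k).
Proof.
move=> kn /andP[]; rewrite le_eqVlt => /predU1P[<- _|tk tk1].
  rewrite subrr sched_flood_ahead ?(ltnW kn)// swept_ahead ?lexx ?ltW//.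
  by rewrite moved0_fun.
by apply: sched_flood_split => //; rewrite tk.
Qed.

Lemma sched_flood_moved k t : (k < n)%N -> sched_time k <= t <= sched_time k.+1 ->
  sched_flood t = ~` ahead (D k) (moved (St k) (t - sched_time k)).
Proof.
move=> kn tk; rewrite (sched_flood_swept kn tk) sched_flood_ahead ?(ltnW kn)//.
by rewrite swept_ahead//; rewrite sched_timeS in tk; lra.
Qed.

Lemma sched_flood_end t : sched_time n <= t -> sched_flood t = setT.
Proof.
move=> nt; apply/seteqP; split=> // p _.
have : sched_flood (sched_time n) p.
  by rewrite sched_flood_ahead// => -[h]; rewrite St_end finset.in_set0.
case=> [|[k [h [s [kn hD hs [tk sk] pE]]]]]; first by left.
by right; exists k, h, s; split=> //; split; lra.
Qed.

Lemma sched_phase t : 0 <= t -> sched_time n <= t \/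
  exists2 k, (k < n)%N & sched_time k <= t <= sched_time k.+1.
Proof.
move=> t0; suff h m : (m <= n)%N -> sched_time m <= t \/
    exists2 k, (k < m)%N & sched_time k <= t <= sched_time k.+1 by exact: h.
elim: m => [_|m IH mn]; first by left; rewrite sched_time0.
have [tm|[k km hk]] := IH (ltnW mn); last by right; exists k => //; apply: ltnW.
have [tm1|tm1] := leP (sched_time m.+1) t; first by left.
by right; exists m; rewrite ?tm ?ltW.
Qed.

Lemma sched_flood_mono s t : 0 <= s <= t -> sched_flood s `<=` sched_flood t.
Proof.
move=> st p [p0|[k [h [r [kn hD hr [ks rs] pE]]]]]; first by left.
by right; exists k, h, r; split=> //; split; lra.
Qed.

Lemma sched_flood_closed t : 0 <= t -> closed (sched_flood t).
Proof.
move=> /sched_phase[/sched_flood_end->|[k kn tk]]; first exact: closedT.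
rewrite (sched_flood_moved kn tk); apply: ahead_closedC => //.
have [fr act] := sched_front (ltnW kn); rewrite sched_timeS in tk.
apply: (moved_front tree fr act); first lra.
by move=> h hD; apply: sched_moved => //; lra.
Qed.

(** Each arm sweeps a segment that starts in the flooded set. Connectedness serves to bound the
    number of components. *)
Lemma swept_connected k t : (k < n)%N -> sched_time k <= t <= sched_time k.+1 ->
  connected (sched_flood (sched_time k)) -> connected (sched_flood t).
Proof.
move=> kn tk ck; have [fr act] := sched_front (ltnW kn).
rewrite (sched_flood_swept kn tk).
pose seg h := sched_flood (sched_time k) `|`
  dpt h @` `[P k h, moved (St k) (t - sched_time k) h].
have [h0 h0D] := sched_nonempty kn.
have start h : h \in D k -> sched_flood (sched_time k) (dpt h (P k h)).
  by move=> hD; rewrite sched_flood_ahead ?(ltnW kn)//; apply: start_flooded => //; apply: act.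
have le_moved h s : h \in D k -> 0 <= s -> P k h <= moved (St k) s h.
  by move=> hD s0; rewrite /moved lerDl mulr_ge0//; exact/ltW/(sched_speed_gt0 kn).
have -> : sched_flood (sched_time k) `|` swept k (t - sched_time k) =
    \bigcup_(h in [set h | h \in D k]) seg h.
  apply/seteqP; split=> p.
    case=> [pk|[h [s [hD hs ->]]]]; first by exists h0 => //; left.
    exists h => //; right; exists (moved (St k) s h) => //; rewrite /= in_itv/=.
    rewrite le_moved ?(andP hs).1//= lerD2l ler_wpM2l ?(andP hs).2//.
    exact/ltW/(sched_speed_gt0 kn).
  move=> [h /= hD [pk|[r /= + <-]]]; first by left.
  rewrite in_itv/= /moved => hr; have z0 := sched_speed_gt0 kn hD.
  right; exists h, ((r - P k h) / ideal_speed (St k) h); split=> //.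
    by apply/andP; split; [apply: divr_ge0|rewrite ler_pdivrMr// mulrC]; lra.
  by rewrite /moved mulrCA divff ?gt_eqF// mulr1; congr dpt; lra.
apply: bigcup_connected.
  by exists (dpt h0 (P k h0)) => h hD; left; apply: start.
move=> h hD; apply: connectedU => //; last exact: dpt_segment_connected.
exists (dpt h (P k h)); split; first exact: start.
by exists (P k h) => //; rewrite /= in_itv/= lexx le_moved//; lra.
Qed.

Lemma sched_flood_connected t : 0 <= t -> connected (sched_flood t).
Proof.
have ck k : (k <= n)%N -> connected (sched_flood (sched_time k)).
  elim: k => [_|k IH kn]; first by rewrite sched_flood_ahead.
  apply: (swept_connected kn); last exact/IH/ltnW.
  by rewrite lexx ltW ?sched_time_lt.
move=> /sched_phase[nt|[k kn tk]]; last by apply: (swept_connected kn tk); apply/ck/ltnW.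
by rewrite (sched_flood_end nt) -(sched_flood_end (lexx _)); apply: ck.
Qed.

Lemma sched_flood_components t : 0 <= t -> finitely_many_components (sched_flood t).
Proof.
move=> /sched_flood_connected ct; apply: (@sub_finite_set _ _ [set sched_flood t]).
  by move=> A [p pt <-]; apply: connected_component_id.
exact: finite_set1.
Qed.

Definition sched_arm k (j : 'I_#|D k|) : normal_vector G :=
  normal_at (enum_val j) (P k (enum_val j)).

Definition sched_speed k (j : 'I_#|D k|) : R := ideal_speed (St k) (enum_val j).

Lemma sched_neqT k : (k < n)%N -> sched_flood (sched_time k) <> setT.
Proof.
move=> kn; rewrite sched_flood_ahead ?(ltnW kn)// => kT.
have [fr act] := sched_front (ltnW kn); have [h hD] := sched_nonempty kn.
suff D0 : D k = finset.set0 by rewrite D0 finset.in_set0 in hD.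
by apply: (active_empty fr act); rewrite -[LHS]setCK kT setCT.
Qed.

Lemma sched_arm_inj k : (k < n)%N -> injective (@sched_arm k).
Proof. by move=> _ i j /normal_at_inj[/enum_val_inj]. Qed.

Lemma sched_arm_range k : (k < n)%N ->
  range (@sched_arm k) = outward_normals (sched_flood (sched_time k)).
Proof.
move=> kn; have [fr act] := sched_front (ltnW kn).
rewrite sched_flood_ahead ?(ltnW kn)//; apply/seteqP; split=> w.
  by move=> [j _ <-]; apply/outward_normalsP => //; exists (enum_val j) => //; apply: enum_valP.
move=> /(outward_normalsP tree _ fr act)[h hD ->].
by exists (enum_rank_in hD h) => //; rewrite /sched_arm enum_rankK_in.
Qed.

Lemma sched_speed_ge0 k : (k < n)%N -> forall j, 0 <= @sched_speed k j.
Proof. by move=> kn j; apply/ltW/(sched_speed_gt0 kn)/enum_valP. Qed.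

Lemma sched_speed_sum k : (k < n)%N -> \sum_(j < #|D k|) sched_speed j = 1.
Proof.
move=> kn; have [fr act] := sched_front (ltnW kn); have [h hD] := sched_nonempty kn.
by rewrite -[RHS](ideal_speed_sum act hD) [RHS]big_enum_val.
Qed.

Lemma sched_times_inf k : (k < n)%N ->
  (sched_time k.+1)%:E = ereal_inf [set t%:E | t in
    stopping_times (sched_time k) (@sched_arm k) (@sched_speed k)].
Proof.
move=> kn; have [fr act] := sched_front (ltnW kn).
have [le_len [h1 h1D h1E] _ _] := St_step kn.
have coordE (j : 'I_#|D k|) s : Defs.coord (sched_arm j) (sched_speed j * s) =
    dart_coord (enum_val j) (moved (St k) s (enum_val j)).
  by rewrite /sched_arm coord_normal_at.
apply: le_anti; apply/andP; split.
  apply: le_ereal_inf_tmp => _ [t [tk stop] <-]; rewrite lee_fin leNgt; apply/negP => tk1.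
  rewrite sched_timeS in tk1.
  have m0 (j : 'I_#|D k|) s : 0 <= s -> P k (enum_val j) <= moved (St k) s (enum_val j) :> R.
    move=> s0; rewrite /moved lerDl mulr_ge0//.
    exact: (sched_speed_ge0 kn j).
  case: stop => [[j]|[j1 [j2 [jN eE]]]]; rewrite !coordE.
    apply; rewrite /= dart_coord_bound; have jD := enum_valP j.
    rewrite sched_moved//; last lra.
    by have := fr.1 _ jD; have := m0 j (t - sched_time k); lra.
  have {}eE : (enum_val j1).1 = (enum_val j2).1 by [].
  (* Two distinct arms on one edge are opposite; if they met, the meeting point would be ahead of
     both at the start of the phase. *)
  have [E|E] := dart_eqP eE; first by case: jN; apply: enum_val_inj.
  have D1 := enum_valP j1; have D2 := enum_valP j2.
  have b1 := fr.1 _ D1; have b2 := fr.1 _ D2.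
  set a := moved _ _ _; set b := moved _ _ _.
  have al : a <= len (enum_val j1).1 by apply: sched_moved => //; lra.
  have bl : b <= len (enum_val j2).1 by apply: sched_moved => //; lra.
  have m1 : P k (enum_val j1) < a.
    by rewrite ltrDl mulr_gt0 ?(sched_speed_gt0 kn)//; lra.
  have m2 : P k (enum_val j2) < b.
    by rewrite ltrDl mulr_gt0 ?(sched_speed_gt0 kn)//; lra.
  move=> cE; have dE : dpt (enum_val j1) a = dpt (enum_val j2) b by rewrite /dpt eE cE.
  case: jN; apply: enum_val_inj; apply: (fr.2 _ _ (dpt (enum_val j1) a)) => //.
    by apply: branch_dpt; lra.
  by rewrite dE; apply: branch_dpt; lra.
(* At the end of the phase [h1] is still on its edge and leaves it at any later time, so the infimum
   is approached from above. *)
apply/lee_addgt0Pr => e e0; rewrite -EFinD; apply: ereal_inf_lbound.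
exists (sched_time k.+1 + e) => //; split.
  by have := sched_time_lt k; lra.
left; exists (enum_rank_in h1D h1); rewrite coordE /= dart_coord_bound enum_rankK_in//.
move=> /andP[_]; apply/negP; rewrite -ltNge -h1E /moved ltrD2l.
by rewrite ltr_pM2l ?(sched_speed_gt0 kn)// sched_timeS; lra.
Qed.

Lemma sched_flood_phase k : (k < n)%N -> forall t, sched_time k <= t <= sched_time k.+1 ->
  sched_flood t = sched_flood (sched_time k) `|`
    [set p | exists (j : 'I_#|D k|) s, sched_time k <= s <= t /\
       p = move_along (sched_arm j) (sched_speed j * (s - sched_time k))].
Proof.
move=> kn t tk; rewrite (sched_flood_swept kn tk); congr (_ `|` _).
apply/seteqP; split=> p.
  move=> [h [s [hD hs ->]]]; exists (enum_rank_in hD h), (s + sched_time k).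
  split; first lra.
  by rewrite /sched_arm move_along_normal_at /sched_speed enum_rankK_in// addrK.
move=> [j [s [hs ->]]]; exists (enum_val j), (s - sched_time k).
by split; [exact: enum_valP|lra|rewrite /sched_arm move_along_normal_at].
Qed.

Definition sched : flooding G := Flooding sched_flood_mono sched_flood_closed
  sched_flood_components sched_time0 (fun k _ => sched_time_lt k) sched_flood_end
  sched_neqT sched_arm_inj sched_arm_range sched_speed_ge0 sched_speed_sum
  sched_times_inf sched_flood_phase.

(** Ideal speeds are the equality case of [phase_entropy], so each phase converts the potential it
    loses entirely into entropy. *)
Lemma sched_entropy : entropy sched = potential (D 0) (P 0).
Proof.
pose U k := potential (D k) (P k).
have UE k : (k < n)%N -> U k.+1 - U k = (sched_time k.+1 - sched_time k) *
    \sum_(j < #|D k|) sched_speed j * ln (sched_speed j).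
  move=> kn; have [fr act] := sched_front (ltnW kn).
  have [le_len _ DE PE] := St_step kn; have [h0 h0D] := sched_nonempty kn.
  have := @phase_entropy _ _ (D k) (P k) (ideal_speed (St k)) (tau k) fr act
    (tau_gt0 k) (fun h hD => ltW (sched_speed_gt0 kn hD)) (ideal_speed_sum act h0D) le_len.
  move=> [_ /iffRL/(_ (fun _ _ => erefl))].
  have fr1 := moved_front tree fr act (ltW (tau_gt0 k)) le_len.
  rewrite -(renew_potential tree fr1) -DE -PE -/(U k) -/(U k.+1) sched_timeS.
  rewrite big_enum_val /= -/(sched_speed _) => UE.
  have -> : sched_time k + tau k - sched_time k = tau k by lra.
  by lra.
have Un : U n = 0 by rewrite /U /potential /unflooded St_end !big_set0 /xlnx mul0r subrr.
rewrite /entropy /= -/(U 0%N); have := telescope_sumr U (leq0n n).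
rewrite big_mkord Un sub0r => /(congr1 -%R); rewrite opprK => <-.
by congr (- _); apply: eq_bigr => k _; rewrite UE.
Qed.

End scheduled_flooding.

Lemma optimal_flooding_ex (R : realType) (G : metric_graph R) (h : dart G) (u : R) :
  is_tree G -> 0 <= u < len h.1 ->
  exists2 g : flooding G, g 0 = [set dpt h u] & entropy g = start_bound h u.
Proof.
move=> tree hu; have hu' : 0 <= u <= len h.1 by lra.
have fr0 := start_front tree hu'.
pose S : @state R G := (renew_darts (start_darts h) (start_pos h u),
                       renew_pos (start_darts h) (start_pos h u)).
have fr : front S.1 S.2 by apply: renew_front.
have act : active S.1 S.2 by apply: renew_active.
have aE : ~` ahead S.1 S.2 = [set dpt h u] by rewrite renew_ahead// start_ahead// setCK.
pose m := Num.bound (\sum_(g in S.1) edges_left g (S.2 g)).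
have [|n [St [tau [S0 t0 stp Sn]]]] := @schedule_ex R G tree m S fr act.
  apply/ltW/archi_boundP; apply: sumr_ge0 => g _.
  by rewrite addr_ge0// sumr_ge0.
rewrite -S0 in fr act aE.
have cA : connected (~` ahead (St 0%N).1 (St 0%N).2) by rewrite aE; apply: connected1.
exists (sched tree fr act cA t0 stp Sn).
  by rewrite /= -(sched_time0 tau) (@sched_flood_ahead _ _ tree n).
by rewrite sched_entropy S0 renew_potential// start_potential.
Qed.

(** * The theorem *)

Section centroid.
Context {R : realType} {G : metric_graph R}.
Hypothesis tree : is_tree G.

(** Along one edge the bound varies only through [xlnx] of the two lengths on either side, whose sum
    is fixed. Making these lengths less unequal decreases the sum of the two [xlnx]; [kl_ge0] at the
    new lengths [p] and [q] is the tangent inequality that shows it, with slope [ln p - ln q]. *)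
Lemma start_bound_increase (h : dart G) (u : R) : 0 <= u < len h.1 ->
  total_length G / 2 < resid h u ->
  exists2 u', u < u' < len h.1 & start_bound h u < start_bound h u'.
Proof.
move=> hu hr.
(* The step stays inside the edge and keeps more than half of the total length ahead, so that
   [q < p] still holds after the move. *)
have [||e e1 e2] := @lt_both _ (resid h u - total_length G / 2) (len h.1 - u); [lra|lra|].
exists (u + e); first lra.
pose p := resid h u - e; pose q := resid (opp h) (len h.1 - u) + e.
have ro := resid_opp tree h u.
have r0 : 0 <= resid h u by apply/ltW/resid_gt0; case/andP: hu.
have o0 : 0 <= resid (opp h) (len h.1 - u).
  by rewrite /resid /=; have := mass_ge0 (opp h); lra.
have q0 : 0 < q by rewrite /q; lra.
have qp : q < p by rewrite /q /p; lra.
have p0 : 0 < p := lt_trans q0 qp.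
have := kl_ge0 r0 p0; have := kl_ge0 o0 q0.
have lnqp : ln q < ln p by rewrite ltr_ln.
have pE : resid h (u + e) = p by rewrite /p /resid; lra.
have qE : resid (opp h) (len h.1 - (u + e)) = q by rewrite /q /resid /=; lra.
rewrite /start_bound /cost pE qE.
have e0 : 0 < e by lra.
have : 0 < e * (ln p - ln q) by rewrite mulr_gt0// subr_gt0.
have -> : resid h u = p + e by rewrite /p; lra.
have -> : resid (opp h) (len h.1 - u) = q - e by rewrite /q; lra.
rewrite /kl [xlnx p]/xlnx [xlnx q]/xlnx; lra.
Qed.

Lemma times_ge0 (f : flooding G) k : (k <= nphases f)%N -> 0 <= times f k.
Proof.
elim: k => [|k IH kn]; first by rewrite times0.
by apply: le_trans (IH (ltnW kn)) (ltW (times_lt kn)).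
Qed.

(** The bound is attained from every starting point, so the supremum dominates all these bounds; [f]
    cannot exceed the bound of its own starting point and therefore reaches it. *)
Lemma max_entropy_start (f : flooding G) (h : dart G) (u : R) :
  max_entropy f -> f 0 = [set dpt h u] -> 0 <= u < len h.1 ->
  entropy f = start_bound h u /\
  forall (k : dart G) v, 0 <= v < len k.1 -> start_bound k v <= entropy f.
Proof.
move=> [_ fsup] f0 hu.
have ub (k : dart G) v : 0 <= v < len k.1 -> start_bound k v <= entropy f.
  move=> kv; have [g g0 <-] := optimal_flooding_ex tree kv.
  rewrite -lee_fin fsup; apply: ereal_sup_ubound; exists g => //.
  by exists (dpt k v).
split=> //; apply: le_anti; rewrite ub// andbT.
exact: (entropy_le tree hu f0).1.
Qed.

Lemma max_entropy_centroid (f : flooding G) v :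
  max_entropy f -> f 0 = [set v] -> is_centroid v.
Proof.
move=> fmax f0 A cA Av.
have half h u : 0 <= u < len h.1 -> v = dpt h u -> resid h u <= total_length G / 2.
  move=> hu vE; rewrite leNgt; apply/negP => /(start_bound_increase hu)[w hw].
  rewrite vE in f0; have [<- ub] := max_entropy_start fmax f0 hu.
  by apply/negP; rewrite -leNgt ub//; lra.
suff [h [u [hu vE Ah]]] : exists h u, [/\ 0 <= u < len h.1, v = dpt h u & A `<=` branch h u].
  apply: le_trans (length_in_le Ah) _.
  by rewrite length_in_branch// half.
have [h0 [u0 [hu0 vE]]] := dptP_lt v.
have [[p Ap]|A0] := pselect (A !=set0); last first.
  by exists h0, u0; split=> // p Ap; case: A0; exists p.
have hu0' : 0 <= u0 <= len h0.1 by lra.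
have fr0 := start_front tree hu0'.
have : ahead (start_darts h0) (start_pos h0 u0) p.
  by rewrite start_ahead// -vE; apply: Av.
(* After renewal the arms are all the darts that leave [v], also when [v] is a vertex; [A] lies in
   the branch of one of them. *)
rewrite -renew_ahead// => -[h hD hp]; set u := renew_pos _ _ _ in hp.
have hu : 0 <= u < len h.1.
  by rewrite (renew_active tree fr0 hD) andbT; case/andP: ((renew_front tree fr0).1 _ hD).
have vh : v = dpt h u.
  have [g gD ->] := renew_start tree fr0 hD; move: gD; rewrite !finset.inE /start_pos.
  move=> /orP[/eqP->|/eqP->]; first by rewrite eqxx.
  by rewrite (negbTE (opp_neq h0)) dpt_opp.
exists h, u; split=> //; apply: (connected_sub_branch tree _ cA _ Ap hp); first lra.
by rewrite -vh => /Av/(_ erefl).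
Qed.

End centroid.

Theorem theorem4p4 (R : realType) (G : metric_graph R) (f : flooding G)
    (v : points G) :
  is_tree G -> max_entropy f -> f 0 = [set v] ->
  is_centroid v /\
  forall (k : nat) (t : R), (k < nphases f)%N -> times f k < t < times f k.+1 ->
    exists C : 'I_(narms f k) -> set (points G),
      (forall j D, is_branch v (tip j t) D <-> D = C j) /\
      forall j,
        speed f k j = length_in (C j) / \sum_(i < narms f k) length_in (C i) /\
        length_in (C j) / \sum_(i < narms f k) length_in (C i) =
          length_in (C j) / (total_length G - t).
Proof.
move=> tree fmax f0; split; first exact: max_entropy_centroid fmax f0.
move=> k t kn tk; have [h0 [u0 [hu0 vE]]] := dptP_lt v.
have f0' : f 0 = [set dpt h0 u0] by rewrite -vE.
have [fE _] := max_entropy_start tree fmax f0' hu0.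
have [_ /(_ fE k kn)[D [pos [kD zE]]]] := entropy_le tree hu0 f0'.
have [fr act fk uE] := kD.
pose d j : dart G := @arm_dart _ _ f k j.
pose u j := pos (d j) + speed f k j * (t - times f k).
have dD j : d j \in D := (arm_dartE tree kn kD j).1.
have X0 g : g \in D -> 0 < unflooded D pos := @unflooded_gt0 _ _ (D, pos) act g.
have zj j : speed f k j = resid (d j) (pos (d j)) / unflooded D pos.
  rewrite -(dart_speedE tree kn kD) zE//; exact: dD.
(* Optimality forbids arms at rest; this puts every tip strictly inside its edge during the
   phase. *)
have z0 j : 0 < speed f k j.
  by rewrite zj divr_gt0 ?(X0 (d j))// resid_gt0// act.
have hu j : pos (d j) < u j < len (d j).1.
  have := phase_bound tree kn kD (dD j); rewrite (dart_speedE tree kn kD) => le_len.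
  apply/andP; split; first by rewrite ltrDl mulr_gt0//; lra.
  by apply: lt_le_trans le_len; rewrite ltrD2l ltr_pM2l//; lra.
have hpos j : 0 <= pos (d j) by case/andP: (fr.1 _ (dD j)).
have tipE j : tip j t = dpt (d j) (u j).
  by rewrite /tip (arm_dartE tree kn kD j).2 move_along_normal_at.
(* The branch and the whole unflooded part lose length in the ratio [speed f k j], which is also the
   ratio of their lengths at the start of the phase; hence it persists. *)
have lenE j : length_in (branch (d j) (u j)) = speed f k j * (total_length G - t).
  rewrite length_in_branch//; last by have := hu j; have := hpos j; lra.
  have -> : total_length G - t = unflooded D pos - (t - times f k) by rewrite uE; lra.
  rewrite mulrBr {1}zj mulfVK ?gt_eqF ?(X0 (d j))// /resid /u; lra.
have len0 j : 0 < length_in (branch (d j) (u j)).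
  rewrite length_in_branch; [apply: resid_gt0| |]; have := hu j; have := hpos j => //; lra.
exists (fun j => branch (d j) (u j)); split.
  move=> j B; rewrite tipE; apply: is_branchP => //.
    by have := hu j; have := hpos j; lra.
  (* [v] is flooded from time 0 on, hence not ahead of any arm, and so it lies behind the tip. *)
  have vk : ~ branch (d j) (pos (d j)) v.
    move=> vb; have : f (times f k) v.
      apply: (@flood_mono _ _ f 0); last by rewrite f0.
      by rewrite lexx times_ge0// ltnW.
    by rewrite fk; apply; exists (d j).
  have uj : 0 <= u j <= len (d j).1 by have := hu j; have := hpos j; lra.
  have [|vb|//] := branch_opp_cover tree uj (p := v).
    by move=> vu; apply: vk; rewrite vu; apply: branch_dpt => //; have := hu j; lra.
  by exfalso; apply: vk; apply: branch_sub vb => //; have := hu j; have := hpos j; lra.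
move=> j; have -> : \sum_(i < narms f k) length_in (branch (d i) (u i)) = total_length G - t.
  by under eq_bigr do rewrite lenE; rewrite -mulr_suml speed_sum// mul1r.
split=> //; rewrite lenE mulfK// gt_eqF//.
by have := len0 j; rewrite lenE pmulr_rgt0.
Qed.
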